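(* There exist universal constants $C>0$ and $C'\ge 1$ such that the following holds. Suppose $G$ is an infinite, connected, amenable, transitive $d$-regular graph with path metric $\mathsf{dist}$, and let $\{X_t\}_{t\ge 0}$ be the simple random walk on $G$ with $X_0$ arbitrary. Then for every time $t\ge 0$, $$\mathbb{E}\left[\mathsf{dist}(X_0,X_t)^2\right]\ \ge\ t/d .$$ Moreover, for every $t\ge d$, $$\mathbb{E}\left[\mathsf{dist}(X_0,X_t)\right]\ \ge\ C\sqrt{t/d},$$ and for every $\varepsilon\ge 1/\sqrt t$, $$\frac1t\sum_{s=0}^t \mathbb{P}\left[\mathsf{dist}(X_0,X_s)\le \varepsilon\sqrt{t/d}\right]\ \le\ C'\varepsilon .$$
   Context: A graph is transitive if its automorphism group acts transitively on its vertices. A graph $G$ is amenable if there exists a sequence of finite subsets $\{S_j\}$ of the vertices such that $|S_j\triangle N(S_j)|/|S_j|\to 0$, where $N(S_j)$ denotes the neighborhood of $S_j$ in $G$. Self-loops are allowed (a loop counts once toward the degree). The simple random walk on a $d$-regular graph traverses at each step a uniformly random one of the $d$ edges at the current vertex; time $t$ is an integer. *)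

(* Defs.v *)
From HB Require Import structures.
From mathcomp Require Import all_boot all_order all_algebra.
From mathcomp Require Import finmap.
From mathcomp Require Import all_classical all_reals all_analysis.
Set Implicit Arguments.
Unset Strict Implicit.
Unset Printing Implicit Defensive.
Import Order.TTheory GRing.Theory Num.Theory.
Import numFieldNormedType.Exports.
Local Open Scope classical_set_scope.
Local Open Scope ring_scope.

(* A graph on V is a symmetric relation e : rel V, not assumed irreflexive:
   there are no multiple edges, and each vertex carries at most one loop,
   which contributes one element to its neighbour set, hence 1 to its degree. *)

Definition regular_graph (V : choiceType) (e : rel V) (d : nat) : Prop :=
  forall x, ([set y | e x y] #= `I_d)%card.

Definition has_walk (V : choiceType) (e : rel V) (x y : V) (n : nat) : Prop :=
  exists p : seq V, [/\ path e x p, last x p = y & size p = n].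

Definition connected_graph (V : choiceType) (e : rel V) : Prop :=
  forall x y, exists n, has_walk e x y n.

(* The value 0 for x, y in different components is a junk value. *)
Definition graph_dist (V : choiceType) (e : rel V) (x y : V) : nat :=
  if pselect (exists n, `[< has_walk e x y n >]) is left xy then ex_minn xy
  else 0%N.

Definition graph_automorphism (V : choiceType) (e : rel V) (f : V -> V) : Prop :=
  bijective f /\ forall x y, e (f x) (f y) = e x y.

Definition transitive_graph (V : choiceType) (e : rel V) : Prop :=
  forall x y, exists2 f, graph_automorphism e f & f x = y.

(* This is the open neighbourhood: a vertex of S belongs to it only if it is
   adjacent to a vertex of S. *)
Definition neighborhood (V : choiceType) (e : rel V) (S : set V) : set V :=
  [set y | exists2 x, S x & e x y].

(* S `+` T is the symmetric difference. fset_set sends infinite sets to fset0,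
   but neighborhood e (S j) is finite whenever e is locally finite.
   Nonemptiness is explicit because 0 / 0 = 0. *)
Definition amenable_graph (R : realType) (V : choiceType) (e : rel V) : Prop :=
  exists S : nat -> set V,
    [/\ forall j, finite_set (S j),
        forall j, S j !=set0 &
        (fun j => #|` fset_set (S j `+` neighborhood e (S j))|%:R
                  / #|` fset_set (S j)|%:R : R) @ \oo --> (0 : R)].

Definition srw_step (R : realType) (V : choiceType) (e : rel V) (d : nat)
    (x y : V) : R := if e x y then d%:R^-1 else 0.

(* The Markov property, in product form so that conditioning on null events
   does not arise. The law of X 0 is unconstrained. V carries the discrete
   sigma-algebra; V being countable, measurability of each X t amounts to
   measurability of its fibres. *)
Definition simple_random_walk (R : realType) (V : choiceType) (e : rel V)
    (d : nat) (disp : measure_display) (Omega : measurableType disp)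
    (P : probability Omega R) (X : nat -> Omega -> V) : Prop :=
  (forall t v, measurable (X t @^-1` [set v])) /\
  (forall (t : nat) (x : nat -> V) (y : V),
    P [set w | (forall s, (s <= t)%N -> X s w = x s) /\ X t.+1 w = y] =
    (P [set w | forall s, (s <= t)%N -> X s w = x s]
     * (srw_step R e d (x t) y)%:E)%E).

(* Main.v *)
Require Import Defs.
From HB Require Import structures.
From mathcomp Require Import all_boot all_order all_algebra.
From mathcomp Require Import finmap.
From mathcomp Require Import all_classical all_reals all_analysis.
From mathcomp Require Import measurable_realfun ring lra.
Set Implicit Arguments.
Unset Strict Implicit.
Unset Printing Implicit Defensive.
Import Order.TTheory GRing.Theory Num.Theory.
Import numFieldNormedType.Exports.
Local Open Scope classical_set_scope.
Local Open Scope ring_scope.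

(* On an infinite amenable graph there are finitely supported functions [f] that
   are almost harmonic relative to their Dirichlet energy. Amenability also gives
   the mass transport principle, so that averaging [f] over the translates by all
   automorphisms (restricted to a large ball) yields a map from the ball to a
   finite-dimensional Euclidean space which is almost harmonic and whose squared
   edge lengths average to exactly [1] at every vertex, hence are at most [d].
   Along the walk this map is almost a martingale with unit variance increments,
   and it is [sqrt d]-Lipschitz. Only the norm [m] of its displacement from the
   starting vertex is needed: [m ^ 2] grows linearly, which is the first bound,
   and the convex function [sqrt (m ^ 2 + 4 rho ^ 2)] grows by at least a multiple
   of [1 / rho] whenever [m <= rho], which bounds the time spent near the start.
   With [rho = 2 sqrt t], where [m <= rho] at least half of the time by Chebyshev,
   the same estimate gives the lower bound on the first moment. *)

(** * Sums and inner products of finitely supported functions *)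

Section FiniteSupport.
Variables (R : realType) (V : choiceType).
Implicit Types (f g h : V -> R) (W : {fset V}).

Definition fin_supp f := exists W, forall x, x \notin W -> f x = 0.

(** The value is [0] when [f] has infinite support, hence the [fin_supp] hypotheses of the linearity
    lemmas. *)
Definition fsum f : R := \sum_(x \in [set: V]) f x.

Lemma fsumE W f : (forall x, x \notin W -> f x = 0) ->
  fsum f = \sum_(x <- W) f x.
Proof.
move=> Wf; rewrite /fsum -(fsbig_widen [set` W])//.
  by rewrite fsbig_finite// set_fsetK.
by move=> x [_ /negP]; exact: Wf.
Qed.

Lemma fin_suppMl f g : fin_supp f -> fin_supp (fun x => f x * g x).
Proof. by move=> [W Wf]; exists W => x /Wf ->; rewrite mul0r. Qed.

(** Linear combinations keep the literal shape [a * f x + b * g x], coefficients [1], [- 1] and [0]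
    included, so that the linearity lemmas apply by unification. *)
Lemma fin_supp_lin a b f g : fin_supp f -> fin_supp g ->
  fin_supp (fun x => a * f x + b * g x).
Proof.
move=> [W Wf] [W' Wg]; exists (W `|` W')%fset => x.
by rewrite in_fsetU negb_or => /andP[/Wf -> /Wg ->]; rewrite !mulr0 addr0.
Qed.

Lemma fsum_lin a b f g : fin_supp f -> fin_supp g ->
  fsum (fun x => a * f x + b * g x) = a * fsum f + b * fsum g.
Proof.
move=> [W Wf] [W' Wg]; pose U := (W `|` W')%fset.
have Uf x : x \notin U -> f x = 0.
  by rewrite in_fsetU negb_or => /andP[/Wf].
have Ug x : x \notin U -> g x = 0.
  by rewrite in_fsetU negb_or => /andP[_ /Wg].
rewrite (fsumE Uf) (fsumE Ug) (@fsumE U) ?big_split/= ?mulr_sumr// => x xU.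
by rewrite Uf// Ug// !mulr0 addr0.
Qed.

Lemma fsum_ge0 f : (forall x, 0 <= f x) -> 0 <= fsum f.
Proof. by move=> f0; apply: fsumr_ge0. Qed.

Lemma ler_fsum f g : fin_supp f -> fin_supp g -> (forall x, f x <= g x) ->
  fsum f <= fsum g.
Proof.
move=> ff fg fgl; have := @fsum_ge0 (fun x => 1 * g x + (- 1) * f x).
rewrite fsum_lin// mul1r mulN1r subr_ge0; apply=> x.
by rewrite mul1r mulN1r subr_ge0.
Qed.

Lemma ler_sum_fsum W f : fin_supp f -> (forall x, 0 <= f x) ->
  \sum_(x <- W) f x <= fsum f.
Proof.
move=> ff f0; pose g x := if x \in W then f x else 0.
have gW x : x \notin W -> g x = 0 by rewrite /g => /negbTE ->.
have -> : \sum_(x <- W) f x = fsum g.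
  rewrite (fsumE gW) [LHS]big_seq [RHS]big_seq.
  by apply: eq_bigr => x; rewrite /g => ->.
by apply: ler_fsum => // [|x]; [exists W | rewrite /g; case: ifP].
Qed.

Definition dot f g := fsum (fun x => f x * g x).

Lemma dotC f g : dot f g = dot g f.
Proof. by congr fsum; apply/funext => x; rewrite mulrC. Qed.

Lemma dot_linl a b f g h : fin_supp f -> fin_supp g ->
  dot (fun x => a * f x + b * g x) h = a * dot f h + b * dot g h.
Proof.
move=> ff fg; rewrite /dot -fsum_lin; [|exact: fin_suppMl..].
by congr fsum; apply/funext => x; rewrite mulrDl !mulrA.
Qed.

Lemma dot_linr a b f g h : fin_supp f -> fin_supp g ->
  dot h (fun x => a * f x + b * g x) = a * dot h f + b * dot h g.
Proof. by move=> ff fg; rewrite dotC dot_linl// ![dot _ h]dotC. Qed.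

Lemma dot_ge0 f : 0 <= dot f f.
Proof. by apply: fsum_ge0 => x; rewrite -expr2 sqr_ge0. Qed.

End FiniteSupport.

(** * The averaging operator [P], the Laplacian and the Dirichlet energy *)

Section Averaging.
Variables (R : realType) (V : choiceType) (e : rel V) (d : nat).
Variable nb : V -> {fset V}.
Hypothesis nbE : forall x y, (y \in nb x) = e x y.
Hypothesis nb_card : forall x, #|` nb x| = d.
Hypothesis e_sym : symmetric e.
Hypothesis d_gt0 : (0 < d)%N.
Implicit Types (f g h : V -> R) (W : {fset V}).

Let dR_neq0 : d%:R != 0 :> R.
Proof. by rewrite pnatr_eq0 -lt0n. Qed.

Definition averaging f x : R := d%:R^-1 * \sum_(y <- nb x) f y.

Lemma sum_nb_const x (a : R) : \sum_(y <- nb x) a = d%:R * a.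
Proof. by rewrite big_const_seq count_predT nb_card iter_addr_0 mulr_natl. Qed.

Lemma avgE f x : \sum_(y <- nb x) f y = d%:R * averaging f x.
Proof. by rewrite /averaging mulrA divff// mul1r. Qed.

Lemma avg_cst (a : R) x : averaging (fun=> a) x = a.
Proof. by rewrite /averaging sum_nb_const mulrA mulVf// mul1r. Qed.

Lemma avg_lin a b f g x :
  averaging (fun x => a * f x + b * g x) x = a * averaging f x + b * averaging g x.
Proof. by rewrite /averaging big_split/= -!mulr_sumr; ring. Qed.

Lemma ler_avg f g x : (forall y, e x y -> f y <= g y) -> averaging f x <= averaging g x.
Proof.
move=> fg; rewrite /averaging ler_wpM2l ?invr_ge0 ?ler0n//.
rewrite big_seq [leRHS]big_seq; apply: ler_sum => y.
by rewrite nbE; exact: fg.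
Qed.

Definition nbhd W : {fset V} := (W `|` \bigcup_(x <- W) nb x)%fset.

Lemma sub_nbhd W x : x \in W -> x \in nbhd W.
Proof. by move=> xW; rewrite in_fsetU xW. Qed.

Lemma nb_nbhd W x y : x \in W -> e x y -> y \in nbhd W.
Proof.
move=> xW xy; rewrite in_fsetU; apply/orP; right.
by apply/bigfcupP; exists x; rewrite ?xW ?nbE.
Qed.

Lemma avg_supp W f : (forall x, x \notin W -> f x = 0) ->
  forall x, x \notin nbhd W -> averaging f x = 0.
Proof.
move=> Wf x xW; rewrite /averaging big_seq big1 ?mulr0// => y; rewrite nbE => xy.
by apply: Wf; apply: contra xW => /nb_nbhd; apply; rewrite e_sym.
Qed.

Lemma fin_supp_avg f : fin_supp f -> fin_supp (averaging f).
Proof. by move=> [W Wf]; exists (nbhd W); exact: avg_supp. Qed.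

Lemma sum_nb_restrict W f x : (forall y, y \notin W -> f y = 0) ->
  \sum_(y <- nb x) f y = \sum_(y <- W | e x y) f y.
Proof.
move=> Wf; pose g y := if e x y then f y else 0.
transitivity (fsum g).
  rewrite (@fsumE _ _ (nb x)) => [|y]; last by rewrite nbE /g => /negbTE ->.
  by rewrite [LHS]big_seq [RHS]big_seq; apply: eq_bigr => y; rewrite nbE /g => ->.
by rewrite [RHS]big_mkcond (@fsumE _ _ W)// => y /Wf; rewrite /g => ->; case: ifP.
Qed.

(** Self-adjointness: both sides are [d^-1] times the sum of [f x * g y] over the ordered edges
    inside the finite set [U], and [e] is symmetric. *)
Lemma dot_avg f g : fin_supp f -> dot f (averaging g) = dot (averaging f) g.
Proof.
move=> [W Wf]; rewrite /dot; set U := nbhd W.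
rewrite (@fsumE _ _ U) => [|x xU]; last first.
  by rewrite Wf ?mul0r//; apply: contra xU; exact: sub_nbhd.
rewrite (@fsumE _ _ U) => [|x /(avg_supp Wf) ->]; last by rewrite mul0r.
have Uf x : x \notin U -> f x = 0.
  by move=> xU; rewrite Wf//; apply: contra xU; exact: sub_nbhd.
rewrite /averaging; under eq_bigr do rewrite mulrCA.
rewrite -mulr_sumr; under [RHS]eq_bigr do rewrite -mulrA.
rewrite -mulr_sumr; congr (_ * _).
transitivity (\sum_(x <- U) \sum_(y <- U | e x y) f x * g y).
  apply: eq_bigr => x _.
  have [xW|/Wf ->] := boolP (x \in W); last first.
    by rewrite mul0r big1// => y _; rewrite mul0r.
  rewrite -mulr_sumr; congr (_ * _).
  pose k y := if y \in U then g y else 0.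
  transitivity (\sum_(y <- nb x) k y).
    rewrite [LHS]big_seq [RHS]big_seq; apply: eq_bigr => y; rewrite nbE => xy.
    by rewrite /k (nb_nbhd xW xy).
  rewrite (@sum_nb_restrict U) => [|y /negbTE]; last by rewrite /k => ->.
  rewrite [LHS]big_seq_cond [RHS]big_seq_cond.
  by apply: eq_bigr => y /andP[yU _]; rewrite /k yU.
rewrite (exchange_big_dep xpredT)//=; apply: eq_bigr => y _.
rewrite (@sum_nb_restrict U)//.
by rewrite mulr_suml; apply: eq_bigl => x; rewrite e_sym.
Qed.

Lemma fsum_avg f : fin_supp f -> fsum (averaging f) = fsum f.
Proof.
move=> ff; have := dot_avg (fun=> 1) ff; rewrite /dot => fa.
transitivity (fsum (fun x => averaging f x * 1)).
  by congr fsum; apply/funext => x; rewrite mulr1.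
by rewrite -fa; congr fsum; apply/funext => x; rewrite avg_cst mulr1.
Qed.

(** The operator [I - P]. *)
Definition laplacian f x := 1 * f x + (- 1) * averaging f x.

Lemma fin_supp_lap f : fin_supp f -> fin_supp (laplacian f).
Proof. by move=> ff; apply: fin_supp_lin => //; exact: fin_supp_avg. Qed.

(** Every edge other than a loop is counted from both endpoints, whence the factor [2] in
    [energyE]. *)
Definition dirichlet_energy f := fsum (fun x => \sum_(y <- nb x) (f y - f x) ^+ 2).

(** Two signs in one computation: [c = - 1] gives the energy, and [c = 1] shows that [I + P] is
    nonnegative, that is, the Laplacian is at most [2]. *)
Lemma fsum_sqr_nb c f : c ^+ 2 = 1 -> fin_supp f ->
  fsum (fun x => \sum_(y <- nb x) (f y + c * f x) ^+ 2) =
  d%:R * 2 * (dot f f + c * dot f (averaging f)).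
Proof.
move=> c1 ff; have fs : fin_supp (fun x => f x * f x) by exact: fin_suppMl.
have fa : fin_supp (fun x => f x * averaging f x) by exact: fin_suppMl.
pose k x := 1 * averaging (fun x => f x * f x) x + 1 * (f x * f x).
have fk : fin_supp k by apply: fin_supp_lin => //; exact: fin_supp_avg.
transitivity (fsum (fun x => d%:R * k x + d%:R * 2 * c * (f x * averaging f x))).
  congr fsum; apply/funext => x.
  have -> : \sum_(y <- nb x) (f y + c * f x) ^+ 2 = \sum_(y <- nb x) (f y * f y)
      + \sum_(y <- nb x) (2 * c * f x) * f y + \sum_(y <- nb x) f x * f x.
    rewrite -!big_split/=; apply: eq_bigr => y _.
    by rewrite sqrrD exprMn c1; ring.
  by rewrite sum_nb_const -mulr_sumr !avgE /k; ring.
rewrite fsum_lin// /k fsum_lin//; last exact: fin_supp_avg.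
by rewrite fsum_avg// /dot; ring.
Qed.

Lemma dot_lap f g : fin_supp f -> fin_supp g -> dot f (laplacian g) = dot (laplacian f) g.
Proof.
move=> ff fg; have fa := fin_supp_avg ff; have ga := fin_supp_avg fg.
by rewrite /laplacian dot_linr// dot_linl// dot_avg.
Qed.

Lemma energyE f : fin_supp f -> dirichlet_energy f = d%:R * 2 * dot f (laplacian f).
Proof.
move=> ff; have fa := fin_supp_avg ff.
rewrite /laplacian dot_linr// mul1r -fsum_sqr_nb ?sqrrN ?expr1n//.
congr fsum; apply/funext => x; apply: eq_bigr => y _.
by rewrite mulN1r.
Qed.

Lemma energy_ge0 f : 0 <= dirichlet_energy f.
Proof. by apply: fsum_ge0 => x; apply: sumr_ge0 => y _; exact: sqr_ge0. Qed.

Lemma dot_lap_ge0 f : fin_supp f -> 0 <= dot f (laplacian f).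
Proof.
by move=> ff; have := energy_ge0 f; rewrite energyE// pmulr_rge0// mulr_gt0 ?ltr0n.
Qed.

Lemma dot_lap_le f : fin_supp f -> dot f (laplacian f) <= 2 * dot f f.
Proof.
move=> ff; have fa := fin_supp_avg ff.
have : 0 <= d%:R * 2 * (dot f f + 1 * dot f (averaging f)).
  rewrite -fsum_sqr_nb ?expr1n//; apply: fsum_ge0 => x.
  by apply: sumr_ge0 => y _; exact: sqr_ge0.
rewrite pmulr_rge0 ?mulr_gt0 ?ltr0n// /laplacian dot_linr//; lra.
Qed.

(** The operator [(I + P) / 2]; laziness makes the loss of energy control the norm of the
    Laplacian. *)
Definition lazy_averaging f x := 1 * f x + (- 2^-1) * laplacian f x.

Lemma fin_supp_lazy f : fin_supp f -> fin_supp (lazy_averaging f).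
Proof. by move=> ff; apply: fin_supp_lin => //; exact: fin_supp_lap. Qed.

Lemma dot_lazy f g : fin_supp f -> fin_supp g ->
  dot f (lazy_averaging g) = dot (lazy_averaging f) g.
Proof.
move=> ff fg; have fa := fin_supp_lap ff; have ga := fin_supp_lap fg.
by rewrite /lazy_averaging dot_linr// dot_linl// dot_lap.
Qed.

Lemma lap_lin a b f g :
  laplacian (fun x => a * f x + b * g x) = fun x => a * laplacian f x + b * laplacian g x.
Proof. by apply/funext => x; rewrite /laplacian avg_lin; ring. Qed.

(** With [L] the Laplacian, one lazy step loses exactly [<Lf, Lf> - <Lf, LLf> / 4] of [<f, Lf>], and
    [L <= 2] bounds the subtracted term by half of [<Lf, Lf>]. *)
Lemma lazy_energy_decr f : fin_supp f ->
  dot (laplacian f) (laplacian f) <=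
  2 * (dot f (laplacian f) - dot (lazy_averaging f) (laplacian (lazy_averaging f))).
Proof.
move=> ff; have fl := fin_supp_lap ff; have fll := fin_supp_lap fl.
have -> : laplacian (lazy_averaging f) =
    fun x => 1 * laplacian f x + (- 2^-1) * laplacian (laplacian f) x.
  exact: lap_lin.
rewrite (dot_linl 1 (- 2^-1) _ ff fl) !(dot_linr 1 (- 2^-1) _ fl fll).
by rewrite (dot_lap ff fl); have := dot_lap_le fl; lra.
Qed.

(** The exact loss is the right-hand side minus a quarter of the squared norm of [laplacian f]. *)
Lemma lazy_norm_decr f : fin_supp f ->
  dot f f - dot (lazy_averaging f) (lazy_averaging f) <= dot f (laplacian f).
Proof.
move=> ff; have fl := fin_supp_lap ff.
rewrite (dot_linl 1 (- 2^-1) _ ff fl) !(dot_linr 1 (- 2^-1) _ ff fl).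
rewrite (dotC (laplacian f) f).
by have := dot_ge0 (laplacian f); lra.
Qed.

End Averaging.

(** * Reachability in a bounded number of steps *)

Section Walks.
Variables (V : choiceType) (e : rel V).

(** Allowing length at most [n] makes the relation monotone in [n] and free of parity
    constraints. *)
Definition reach (n : nat) (x y : V) := exists2 k, (k <= n)%N & has_walk e x y k.

Lemma reach0 n x : reach n x x.
Proof. by exists 0%N => //; exists [::]. Qed.

Lemma reach0E x y : reach 0 x y -> x = y.
Proof. by move=> [k]; rewrite leqn0 => /eqP -> [[|? ?] [_ /= xy]]. Qed.

Lemma reach_leq m n x y : (m <= n)%N -> reach m x y -> reach n x y.
Proof. by move=> mn [k km w]; exists k => //; exact: leq_trans mn. Qed.

Lemma reach_step n x y z : e x y -> reach n y z -> reach n.+1 x z.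
Proof.
move=> xy [k kn [p [pp pl ps]]]; exists k.+1 => //; exists (y :: p).
by split => //=; rewrite ?xy ?ps.
Qed.

Lemma reach_rcons n x y z : reach n x y -> e y z -> reach n.+1 x z.
Proof.
move=> [k kn [p [pp pl ps]]] yz; exists k.+1 => //; exists (rcons p z).
by rewrite rcons_path last_rcons size_rcons pp pl yz ps.
Qed.

Lemma reach_inv n x y : reach n.+1 x y ->
  x = y \/ exists2 z, e x z & reach n z y.
Proof.
move=> [k kn [[|z p] [/= pp pl ps]]]; first by left.
case/andP: pp => xz pp; right; exists z => //; exists (size p).
  by rewrite -ltnS; move: kn; rewrite -ps.
by exists p.
Qed.

Lemma reach_invr n x y : reach n.+1 x y ->
  x = y \/ exists2 z, reach n x z & e z y.
Proof.
move=> [k kn [p]]; case/lastP: p => [|p z] [pp pl ps]; first by left.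
move: pp pl ps; rewrite rcons_path last_rcons size_rcons => /andP[pp pz] <- ps.
right; exists (last x p) => //; exists (size p); last by exists p.
by rewrite -ltnS; move: kn; rewrite -ps.
Qed.

Lemma reach_trans m n x y z : reach m x y -> reach n y z -> reach (m + n) x z.
Proof.
elim: m x => [|m IH] x; first by move/reach0E => ->.
move/reach_inv => [-> w|[t xt ty] w].
  by apply: reach_leq w; rewrite leq_addl.
by rewrite addSn; apply: reach_step xt _; exact: IH.
Qed.

Lemma reach_sym n x y : symmetric e -> reach n x y -> reach n y x.
Proof.
move=> es; elim: n x => [|n IH] x; first by move/reach0E => ->; exact: reach0.
move/reach_inv => [->|[z xz /IH zy]]; first exact: reach0.
by apply: reach_rcons zy _; rewrite es.
Qed.

Lemma reach_automorphism n x y f : graph_automorphism e f ->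
  reach n x y -> reach n (f x) (f y).
Proof.
move=> [_ fe]; elim: n x => [|n IH] x; first by move/reach0E => ->; exact: reach0.
move/reach_inv => [->|[z xz /IH]]; first exact: reach0.
by apply: reach_step; rewrite fe.
Qed.

End Walks.

(** * Almost harmonic functions from Folner sets *)

Section NearHarmonic.
Variables (R : realType) (V : choiceType) (e : rel V) (d : nat).
Variable nb : V -> {fset V}.
Hypothesis nbE : forall x y, (y \in nb x) = e x y.
Hypothesis nb_card : forall x, #|` nb x| = d.
Hypothesis e_sym : symmetric e.
Hypothesis d_gt0 : (0 < d)%N.
Hypothesis V_infinite : infinite_set [set: V].
Hypothesis e_conn : connected_graph e.
Implicit Types (f g h : V -> R) (W : {fset V}).

(** The Folner condition, with [B] covering the outer vertex boundary of [S]. *)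
Definition folner := forall eta : R, 0 < eta -> exists S B : {fset V},
  [/\ S != fset0, (forall x y, x \in S -> e x y -> y \notin S -> y \in B) &
      #|` B|%:R <= eta * #|` S|%:R].

Local Notation avg := (@averaging R V d nb).
Local Notation lap := (@laplacian R V d nb).
Local Notation lazy := (@lazy_averaging R V d nb).
Local Notation energy := (@dirichlet_energy R V nb).

Lemma energy_supp f W : (forall x, x \notin W -> f x = 0) ->
  forall x, x \notin nbhd nb W -> \sum_(y <- nb x) (f y - f x) ^+ 2 = 0.
Proof.
move=> Wf x xW; rewrite big_seq big1// => y; rewrite nbE => xy.
rewrite !Wf ?subr0 ?expr0n//; first by apply: contra xW; exact: sub_nbhd.
by apply: contra xW => /(nb_nbhd nbE); apply; rewrite e_sym.
Qed.

Lemma sqr_edge_le_energy f x y : fin_supp f -> e x y ->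
  (f y - f x) ^+ 2 <= energy f.
Proof.
move=> [W Wf] xy.
have s0 z : 0 <= \sum_(t <- nb z) (f t - f z) ^+ 2.
  by apply: sumr_ge0 => t _; exact: sqr_ge0.
apply: (@le_trans _ _ (\sum_(z <- [fset x]%fset) \sum_(t <- nb z) (f t - f z) ^+ 2)).
  rewrite big_seq_fset1 (big_fsetD1 y) ?nbE//= lerDl.
  by apply: sumr_ge0 => t _; exact: sqr_ge0.
apply: ler_sum_fsum => //.
by exists (nbhd nb W); exact: energy_supp.
Qed.

Lemma reach_energy f (eps : R) n x y : fin_supp f -> 0 <= eps ->
  energy f <= eps ^+ 2 -> reach e n x y -> f x - n%:R * eps <= f y.
Proof.
move=> ff e0 fe; elim: n x => [|n IH] x.
  by move/reach0E => ->; rewrite mul0r subr0.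
move/reach_inv => [->|[z xz /IH zy]].
  by rewrite gerBl mulr_ge0.
have := le_trans (sqr_edge_le_energy ff xz) fe.
rewrite -ler_sqrt ?exprn_ge0// !sqrtr_sqr (ger0_norm e0) ler_norml => /andP[le _].
rewrite -natr1; lra.
Qed.

Definition indic_fset W x : R := (x \in W)%:R.

Lemma fin_supp_indic W : fin_supp (indic_fset W).
Proof. by exists W => x; rewrite /indic_fset => /negbTE ->. Qed.

Lemma dot_indic W g : dot (indic_fset W) g = \sum_(x <- W) g x.
Proof.
rewrite /dot (@fsumE _ _ W).
  by rewrite [LHS]big_seq [RHS]big_seq; apply: eq_bigr => x;
    rewrite /indic_fset => ->; rewrite mul1r.
by move=> x; rewrite /indic_fset => /negbTE ->; rewrite mul0r.
Qed.

Lemma fsum_indic W : fsum (indic_fset W) = #|` W|%:R.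
Proof.
rewrite (@fsumE _ _ W); last by move=> x; rewrite /indic_fset => /negbTE ->.
rewrite -[RHS]mulr1 mulr_natl -iter_addr_0 -count_predT -big_const_seq.
by rewrite [LHS]big_seq [RHS]big_seq; apply: eq_bigr => x; rewrite /indic_fset => ->.
Qed.

Lemma dot_indic_norm W : dot (indic_fset W) (indic_fset W) = #|` W|%:R.
Proof.
rewrite -fsum_indic; congr fsum; apply/funext => x.
by rewrite /indic_fset; case: (x \in W); rewrite ?mulr0 ?mulr1.
Qed.

(** At a vertex of [S] the Laplacian is the proportion of neighbours outside [S], at most the
    proportion in [B]; and averaging preserves the total mass of the indicator of [B]. *)
Lemma dot_lap_indic (S B : {fset V}) :
  (forall x y, x \in S -> e x y -> y \notin S -> y \in B) ->
  dot (indic_fset S) (lap (indic_fset S)) <= #|` B|%:R.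
Proof.
move=> SB; rewrite dot_indic -fsum_indic.
rewrite -(fsum_avg nbE nb_card e_sym d_gt0 (fin_supp_indic B)).
apply: (@le_trans _ _ (\sum_(x <- S) avg (indic_fset B) x)).
  rewrite big_seq [leRHS]big_seq; apply: ler_sum => x xS.
  rewrite /laplacian {1}/indic_fset xS.
  rewrite -(avg_cst nb_card d_gt0 (1 * 1) x) -[X in X + _]mul1r -avg_lin.
  apply: (ler_avg d nbE) => y xy; rewrite /indic_fset.
  have := SB x y xS xy; case: (y \in S) => [_|/(_ isT) ->] /=; last lra.
  by case: (y \in B) => /=; lra.
apply: ler_sum_fsum; first exact: fin_supp_avg (fin_supp_indic B).
move=> x; rewrite -(avg_cst nb_card d_gt0 0 x); apply: (ler_avg d nbE) => y _.
exact: ler0n.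
Qed.

Lemma fin_supp_iter_lazy n f : fin_supp f -> fin_supp (iter n lazy f).
Proof. by move=> ff; elim: n => //= n IH; exact: fin_supp_lazy. Qed.

(** Self-adjointness; for [n = m] it turns a squared norm into the sum of a later average over the
    initial set. *)
Lemma dot_iter_lazy n m f : fin_supp f ->
  dot (iter n lazy f) (iter m lazy f) = dot f (iter (n + m) lazy f).
Proof.
move=> ff; elim: n m => [//|n IH] m.
rewrite iterS -(dot_lazy d nbE e_sym)//; [|exact: fin_supp_iter_lazy..].
by rewrite -iterS IH addnS addSn.
Qed.

Lemma reach_bounded (A B : {fset V}) :
  exists n, forall x y, x \in A -> y \in B -> reach e n x y.
Proof.
have /choice[k kP] : forall p : V * V, exists n, reach e n p.1 p.2.
  by move=> [x y]; have [n w] := e_conn x y; exists n; exists n.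
exists (\max_(x <- A) \max_(y <- B) k (x, y)) => x y xA yB.
apply: reach_leq (kP (x, y)).
apply: leq_trans (_ : \max_(y <- B) k (x, y) <= _)%N.
  exact: (@leq_bigmax_seq _ _ _ (fun y => k (x, y)) y yB isT).
exact: (@leq_bigmax_seq _ _ _ (fun x => \max_(y <- B) k (x, y))%N x xA isT).
Qed.

(* Otherwise the Laplacian would have a spectral gap: the lazy averages of the
   indicator of a Folner set would lose all their energy but at most half of their
   squared norm, and so become almost constant on arbitrarily many vertices. *)
Lemma exists_near_harmonic (delta : R) : folner -> 0 < delta ->
  exists f, [/\ fin_supp f, dot (lap f) (lap f) <= delta * dot f (lap f) &
                0 < dot f (lap f)].
Proof.
move=> fol delta_gt0; apply: contrapT => nex.
have gap f : fin_supp f -> delta * dot f (lap f) <= dot (lap f) (lap f).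
  move=> ff; rewrite leNgt; apply/negP => lt; apply: nex; exists f; split => //.
    exact: ltW.
  by rewrite -(pmulr_rgt0 _ delta_gt0); exact: le_lt_trans (dot_ge0 _) lt.
(* The ratio [delta / 4] makes the initial energy [a 0] at most [delta * s / 4]; telescoping under
   the spectral gap then bounds the sum of all [a i] by [s / 2], half the initial squared norm. *)
have [S [B [S_neq0 SB Bsmall]]] := fol (delta / 4) (divr_gt0 delta_gt0 (ltr0Sn R 3)).
pose s : R := #|` S|%:R.
have s_gt0 : 0 < s by rewrite ltr0n cardfs_gt0.
pose f := indic_fset S; have ff : fin_supp f := fin_supp_indic S.
pose g n := iter n lazy f.
have fg n : fin_supp (g n) by exact: fin_supp_iter_lazy.
pose a n := dot (g n) (lap (g n)).
have a_ge0 n : 0 <= a n by exact: (dot_lap_ge0 nbE nb_card e_sym d_gt0 (fg n)).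
have decr n : dot (lap (g n)) (lap (g n)) <= 2 * (a n - a n.+1).
  by rewrite /a /g iterS; exact: (lazy_energy_decr nbE nb_card e_sym d_gt0 (fg n)).
have a_anti n : a n.+1 <= a n.
  by have := le_trans (dot_ge0 _) (decr n); lra.
have a_sum n : delta * \sum_(i < n) a i <= 2 * (a 0%N - a n).
  elim: n => [|n IH]; first by rewrite big_ord0 mulr0 subrr mulr0.
  by rewrite big_ord_recr/= mulrDr; have := decr n; have := gap _ (fg n);
    rewrite -/(a n); lra.
have a0 : a 0%N <= delta / 4 * s by exact: le_trans (dot_lap_indic SB) Bsmall.
have a_sum_le n : \sum_(i < n) a i <= s / 2.
  by rewrite -(ler_pM2l delta_gt0); have := a_sum n; have := a_ge0 n; lra.
have norm_ge n : s / 2 <= dot (g n) (g n).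
  have : dot (g 0%N) (g 0%N) - dot (g n) (g n) <= \sum_(i < n) a i.
    elim: n => [|n IH]; first by rewrite big_ord0 subrr.
    rewrite big_ord_recr/=.
    have := lazy_norm_decr d nbE e_sym (fg n); rewrite -/(a n) -iterS -/(g n.+1).
    lra.
  rewrite [dot (g 0%N) _]dot_indic_norm -/s; have := a_sum_le n; lra.
have norm_le n : dot (g n) (g n) <= s.
  elim: n => [|n]; first by rewrite dot_indic_norm.
  apply: le_trans.
  have fl := fin_supp_lap d nbE e_sym (fg n).
  rewrite /g iterS -/(g n) (dot_linl 1 (- 2^-1) _ (fg n) fl).
  rewrite !(dot_linr 1 (- 2^-1) _ (fg n) fl) (dotC (lap (g n)) (g n)).
  have := decr n; have := a_ge0 n.+1; have := a_ge0 n.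
  rewrite /a; lra.
have a_small n : n%:R * a n <= s / 2.
  apply: le_trans (a_sum_le n).
  have -> : n%:R * a n = \sum_(i < n) a n.
    by rewrite sumr_const card_ord mulr_natl.
  apply: ler_sum => i _; elim: n i => [[]//|n IH] i.
  have := ltn_ord i; rewrite ltnS leq_eqVlt => /orP[/eqP ->//|iltn].
  exact: le_trans (a_anti n) (IH (Ordinal iltn)).
(* A function at least [1 / 4] on more than [16 * s] vertices has squared norm above [s], which
   contradicts [norm_le]. *)
have [M _ M_card] := infinite_set_fset (16 * #|` S| + 1) V_infinite.
have [K KP] := reach_bounded S M.
(* A variation of at most [eps] per edge costs at most [1 / 4] along [K] steps, so a value [1 / 2]
   on [S] leaves [1 / 4] on all of [M]. *)
pose eps : R := (4 * K.+1%:R)^-1.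
have eps_gt0 : 0 < eps by rewrite invr_gt0 mulr_gt0 ?ltr0n.
have [n n_large] : exists n, d%:R * s / eps ^+ 2 <= n%:R.
  exists (Num.truncn (d%:R * s / eps ^+ 2)).+1.
  by apply/ltW; exact: truncnS_gt.
have n_gt0 : 0 < n%:R :> R.
  apply: lt_le_trans n_large; apply: divr_gt0; last exact: exprn_gt0.
  by apply: mulr_gt0 => //; rewrite ltr0n.
have small_energy : energy (g (n + n)%N) <= eps ^+ 2.
  rewrite (energyE nbE nb_card e_sym d_gt0)// -/(a (n + n)%N).
  rewrite -(ler_pM2l n_gt0).
  have nn := a_small (n + n)%N; move: n_large.
  rewrite ler_pdivrMr ?exprn_gt0// => n_large.
  apply: le_trans n_large; rewrite natrD in nn.
  rewrite mulrCA -mulrA ler_pM2l ?ltr0n//; lra.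
(* The sum of [g (n + n)] over [S] is the squared norm of [g n], at least [s / 2], so its mean over
   [S] is at least [1 / 2]. *)
have [x xS gx] : exists2 x, x \in S & 2^-1 <= g (n + n)%N x.
  apply: contrapT => nx.
  have : \sum_(x <- S) g (n + n)%N x < \sum_(x <- S) 2^-1.
    rewrite big_seq [ltRHS]big_seq; apply: ltr_sum => [|x xS].
      by have [y yS] := fset0Pn _ S_neq0; apply/hasP; exists y.
    by rewrite ltNge; apply/negP => gx; apply: nx; exists x.
  rewrite -dot_indic -/f -dot_iter_lazy//.
  rewrite big_const_seq count_predT iter_addr_0 -[_ *+ _]mulr_natl -/s.
  by have := norm_ge n; lra.
have gM y : y \in M -> 4^-1 <= g (n + n)%N y.
  move=> yM; have := reach_energy (fg (n + n)%N) (ltW eps_gt0) small_energy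
    (KP x y xS yM).
  have : K%:R * eps <= 4^-1.
    rewrite /eps invfM mulrCA ler_piMr// ler_pdivrMr ?ltr0n// mul1r ler_nat//.
  by lra.
have : \sum_(y <- M) 16^-1 <= s.
  apply: le_trans (norm_le (n + n)%N).
  apply: le_trans (_ : \sum_(y <- M) g (n + n)%N y * g (n + n)%N y <= _).
    rewrite big_seq [leRHS]big_seq; apply: ler_sum => y /gM gy.
    have -> : 16^-1 = 4^-1 * 4^-1 :> R by rewrite -invfM -natrM.
    exact: ler_pM.
  by apply: ler_sum_fsum; [exact: fin_suppMl | move=> y; rewrite -expr2 sqr_ge0].
rewrite big_const_seq count_predT iter_addr_0 -[_ *+ _]mulr_natl.
have : (16 * s + 1) <= #|` M|%:R by rewrite /s -natrM natr1 ler_nat -addn1.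
lra.
Qed.

End NearHarmonic.

(** * Automorphisms restricted to a ball, and mass transport *)

Section LocalAutomorphisms.
Variables (R : realType) (V : choiceType) (e : rel V) (d : nat).
Variable nb : V -> {fset V}.
Hypothesis nbE : forall x y, (y \in nb x) = e x y.
Hypothesis nb_card : forall x, #|` nb x| = d.
Hypothesis e_sym : symmetric e.
Hypothesis e_trans : transitive_graph e.
Hypothesis fol : folner R e.
Implicit Types (F W : {fset V}) (phi : V -> V).

Fixpoint gball n (x : V) : {fset V} :=
  if n is k.+1 then nbhd nb (gball k x) else [fset x]%fset.

Lemma gballP n x y : reflect (reach e n x y) (y \in gball n x).
Proof.
apply: (iffP idP); elim: n y => [|n IH] y /=.
- by rewrite in_fset1 => /eqP ->; exact: reach0.
- rewrite in_fsetU => /orP[/IH|/bigfcupP[z /andP[/IH xz _]]].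
    by apply: reach_leq.
  by rewrite nbE; exact: reach_rcons.
- by move/reach0E => ->; rewrite in_fset1.
- move/reach_invr => [<-|[z /IH xz zy]]; last exact: nb_nbhd xz zy.
  by apply/sub_nbhd/IH; exact: reach0.
Qed.

Variables (o : V) (n : nat).
Local Notation B := (gball n o).

(* Functions agreeing with an automorphism on [B]; the value [o] outside [B]
   makes each of them determined by its restriction to [B], so that finitely many
   send a given point of [B] to a given vertex. *)
Definition local_aut : set (V -> V) :=
  [set phi | (exists2 s, graph_automorphism e s &
               forall v, v \in B -> phi v = s v) /\
             forall v, v \notin B -> phi v = o].

Definition fiber y F : set (V -> V) := local_aut `&` [set phi | phi y \in F].

(** Automorphisms map walks to walks, so all of [B] lands within [n + n] steps of [F], and [ext]
    recovers [phi] from its restriction to [B]. *)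
Lemma finite_fiber y F : y \in B -> finite_set (fiber y F).
Proof.
move=> yB; pose U := (o |` \bigcup_(w <- F) gball (n + n) w)%fset.
pose ext (f : {ffun B -> U}) (v : V) : V := if insub v is Some b then val (f b) else o.
apply: (@sub_finite_set _ _ (ext @` setT)); last exact/finite_image/finite_finset.
move=> phi [[[s sa sphi] phio] /= phiy].
have phiU (b : B) : phi (val b) \in U.
  rewrite in_fset1U; apply/orP; right; apply/bigfcupP; exists (phi y).
    by rewrite phiy.
  apply/gballP; rewrite !sphi ?(valP b)//; apply: reach_automorphism => //.
  apply: reach_trans (_ : reach e n o (val b)); last exact/gballP/(valP b).
  by apply: reach_sym => //; exact/gballP.
exists [ffun b => [` phiU b]%fset] => //; apply/funext => v.
rewrite /ext; case: insubP => [b vB <-|/phio//]; by rewrite ffunE.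
Qed.

(** A counting substitute for the Haar measure of the set of automorphisms sending [y] to [w]. *)
Definition multiplicity y w := #|` fset_set (fiber y [fset w]%fset)|.

(** Composition with [s] on [B], which is [tr], injects the first fibre into the second. *)
Lemma multiplicity_automorphism y w s : y \in B -> graph_automorphism e s ->
  (multiplicity y w <= multiplicity y (s w))%N.
Proof.
move=> yB sa; pose tr phi v := if v \in B then s (phi v) else o.
have [[s' sK _] se] := sa.
set A := fset_set (fiber y [fset w]%fset).
have trA : #|` [fset tr phi | phi in A]%fset| = #|` A|.
  rewrite card_in_imfset//= => phi phi'.
  rewrite !in_fset_set ?inE; [|exact: finite_fiber..].
  move=> [[_ phio] _] [[_ phio'] _] trE; apply/funext => v.
  have [vB|vB] := boolP (v \in B); last by rewrite phio// phio'.
  by apply: (can_inj sK); have := congr1 (@^~ v) trE; rewrite /tr vB.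
rewrite /multiplicity -/A -trA; apply: fsubset_leq_card.
apply/fsubsetP => _ /imfsetP[phi /= + ->].
rewrite !in_fset_set ?inE; [|exact: finite_fiber..].
move=> [[[t [tb te] tphi] phio] /=]; rewrite in_fset1 => /eqP phiy.
split; last by rewrite /= /tr yB in_fset1 phiy.
split; last by move=> v /negbTE vB; rewrite /tr vB.
exists (s \o t); last by move=> v vB; rewrite /tr vB /= tphi.
split; first by apply: bij_comp => //; exact: sa.1.
by move=> a b /=; rewrite se te.
Qed.

Lemma multiplicityE y w : y \in B -> multiplicity y w = multiplicity y o.
Proof.
move=> yB; apply/eqP; rewrite eqn_leq; apply/andP; split.
  by have [s sa <-] := e_trans w o; exact: multiplicity_automorphism.
by have [s sa <-] := e_trans o w; exact: multiplicity_automorphism.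
Qed.

(** Group the maps by the vertex [phi y]: each [w] in [W] is hit [multiplicity y w] times, and by
    transitivity this number is independent of [w]. *)
Lemma sum_fiber y W (T : {fset V -> V}) (h : V -> R) : y \in B ->
  (forall phi, phi \in T -> local_aut phi) ->
  (forall phi, fiber y W phi -> phi \in T) ->
  (forall w, w \notin W -> h w = 0) ->
  \sum_(phi <- T) h (phi y) = (multiplicity y o)%:R * \sum_(w <- W) h w.
Proof.
move=> yB TL LT Wh.
transitivity (\sum_(phi <- T) \sum_(w <- W | phi y == w) h w).
  apply: eq_bigr => phi _; have [phiW|phiW] := boolP (phi y \in W).
    under eq_bigl do rewrite eq_sym.
    by rewrite -big_filter filter_pred1_uniq// big_seq1.
  rewrite Wh// big_seq_cond big1// => w /andP[wW /eqP pw].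
  by move: phiW; rewrite pw wW.
rewrite (exchange_big_dep xpredT)//= mulr_sumr [LHS]big_seq [RHS]big_seq.
apply: eq_bigr => w wW.
rewrite big_const_seq iter_addr_0 mulr_natl; congr (_ *+ _).
rewrite -(multiplicityE w yB) /multiplicity -size_filter.
apply: perm_size; apply: uniq_perm; rewrite ?filter_uniq ?fset_uniq// => phi.
rewrite mem_filter in_fset_set; last exact: finite_fiber.
apply/andP/idP => [[/eqP py /TL pL]|].
  by rewrite inE; split => //=; rewrite py in_fset1.
rewrite inE => -[pL /=]; rewrite in_fset1 => /eqP py; split; first exact/eqP.
by apply: LT; split => //=; rewrite py.
Qed.

Lemma card_fiber y F : y \in B ->
  #|` fset_set (fiber y F)|%:R = (multiplicity y o)%:R * #|` F|%:R :> R.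
Proof.
move=> yB; have := @sum_fiber y F (fset_set (fiber y F)) (indic_fset R F) yB.
have -> : \sum_(w <- F) indic_fset R F w = #|` F|%:R.
  by rewrite -dot_indic dot_indic_norm.
move=> <-; last by move=> w; rewrite /indic_fset => /negbTE ->.
- rewrite -[LHS]mulr1 mulr_natl -iter_addr_0 -count_predT -big_const_seq.
  rewrite [LHS]big_seq [RHS]big_seq; apply: eq_bigr => phi.
  rewrite in_fset_set; last exact: finite_fiber.
  by rewrite inE => -[_ /=]; rewrite /indic_fset => ->.
- by move=> phi; rewrite in_fset_set; [rewrite inE => -[]|exact: finite_fiber].
- by move=> phi phiF; rewrite in_fset_set; [rewrite inE|exact: finite_fiber].
Qed.

(* Mass transport: a local automorphism mapping [y] into a Folner set [S] maps
   the neighbour [y'] into [S] or its small boundary. *)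
Lemma multiplicity_edge_le y y' : y \in B -> y' \in B -> e y y' ->
  (multiplicity y o <= multiplicity y' o)%N.
Proof.
move=> yB y'B yy'; rewrite -(ler_nat R); apply/ler_addgt0Pr => eps eps_gt0.
set c := _%:R; set c' := _%:R.
have c'_ge0 : 0 <= c' by exact: ler0n.
(* With ratio [eps / (c' + 1)] the boundary contributes at most [eps] times the size of [S]. *)
have [S [D [S_neq0 SD Dsmall]]] := fol (divr_gt0 eps_gt0 (ltr_wpDl c'_ge0 ltr01)).
have s_gt0 : 0 < #|` S|%:R :> R by rewrite ltr0n cardfs_gt0.
rewrite -(ler_pM2r s_gt0) -(card_fiber S yB).
apply: (@le_trans _ _ #|` fset_set (fiber y' (S `|` D)%fset)|%:R).
  rewrite ler_nat; apply: fsubset_leq_card; apply/fsubsetP => phi.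
  rewrite !in_fset_set ?inE; [|exact: finite_fiber..].
  move=> [phiL /= phiS]; split => //=; have [[s [_ se] sphi] _] := phiL.
  rewrite in_fsetU; have [//|phi'S] := boolP (phi y' \in S).
  by rewrite (SD (phi y))// !sphi// se.
rewrite card_fiber// -/c'.
apply: (@le_trans _ _ (c' * (#|` S|%:R + #|` D|%:R))).
  by rewrite ler_wpM2l// -natrD ler_nat cardfsU leq_subr.
rewrite mulrDr mulrDl lerD2l.
apply: (le_trans (ler_wpM2l c'_ge0 Dsmall)).
rewrite mulrA ler_pM2r// mulrCA ler_piMr//; first exact: ltW.
by rewrite ler_pdivrMr ?mul1r ?lerDl ?ler01// ltr_wpDl.
Qed.

(** Unimodularity: the edge inequality holds in both directions, so the multiplicity is constant
    along a walk from [o] inside [B]. *)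
Lemma multiplicity_center y : y \in B -> multiplicity y o = multiplicity o o.
Proof.
have oB : o \in B by apply/gballP; exact/(reach_leq (leq0n n))/reach0.
suff H k : (k <= n)%N -> forall z, reach e k o z -> multiplicity z o = multiplicity o o.
  by move/gballP; exact: H.
elim: k => [_ z /reach0E -> //|k IH kn z /reach_invr[<-//|[t ot tz]]].
rewrite -(IH (ltnW kn) t ot).
have tB : t \in B by apply/gballP; apply: reach_leq ot; exact: ltnW.
have zB : z \in B by apply/gballP; apply: reach_leq kn _; exact: reach_rcons tz.
by apply/eqP; rewrite eqn_leq !multiplicity_edge_le// e_sym.
Qed.

Lemma multiplicity_gt0 : (0 < multiplicity o o)%N.
Proof.
have oB : o \in B by apply/gballP; exact/(reach_leq (leq0n n))/reach0.
rewrite cardfs_gt0; apply/fset0Pn.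
exists (fun v => if v \in B then v else o).
rewrite in_fset_set; last exact: finite_fiber.
rewrite inE; split; last by rewrite /= oB in_fset1.
split; last by move=> v /negbTE ->.
exists id; last by move=> v ->.
by split => //; exists id.
Qed.

Lemma sum_nb_local_aut phi y (h : V -> R) : local_aut phi -> y \in B ->
  (forall z, e y z -> z \in B) ->
  \sum_(z <- nb y) h (phi z) = \sum_(w <- nb (phi y)) h w.
Proof.
move=> [[s [sb se] sphi] _] yB nyB; have [s' sK s'K] := sb.
have -> : nb (phi y) = [fset s z | z in nb y]%fset.
  apply/fsetP => w; rewrite nbE sphi//; apply/idP/imfsetP => [syw|[z /= + ->]].
    by exists (s' w); rewrite ?s'K//= nbE -se s'K.
  by rewrite nbE se.
rewrite big_imfset/=; last by move=> ? ? _ _; exact: (can_inj sK).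
rewrite [LHS]big_seq [RHS]big_seq; apply: eq_bigr => z.
by rewrite nbE => /nyB zB; rewrite sphi.
Qed.

End LocalAutomorphisms.

(** * Finite-dimensional Euclidean norms *)

Section L2Norm.
Variables (R : realType) (I : Type) (r : seq I).
Implicit Types u v : I -> R.

Definition l2norm u := Num.sqrt (\sum_(i <- r) u i ^+ 2).

Lemma l2norm_ge0 u : 0 <= l2norm u. Proof. exact: sqrtr_ge0. Qed.

Lemma sqr_l2norm u : l2norm u ^+ 2 = \sum_(i <- r) u i ^+ 2.
Proof. by rewrite sqr_sqrtr// sumr_ge0// => i _; exact: sqr_ge0. Qed.

(** Weighted arithmetic-geometric inequality with the optimal weight, the ratio of the norms; if one
    norm vanishes, the weight is instead taken small or large in terms of [eps]. *)
Lemma l2norm_cauchy u v : \sum_(i <- r) u i * v i <= l2norm u * l2norm v.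
Proof.
have sum_le s : 0 < s ->
    2 * \sum_(i <- r) u i * v i <= s * l2norm u ^+ 2 + s^-1 * l2norm v ^+ 2.
  move=> s_gt0; rewrite !sqr_l2norm !mulr_sumr -big_split/=; apply: ler_sum => i _.
  have : 0 <= s * (u i - s^-1 * v i) ^+ 2 by rewrite mulr_ge0 ?sqr_ge0 ?ltW.
  have -> : s * (u i - s^-1 * v i) ^+ 2 =
    s * u i ^+ 2 + s^-1 * v i ^+ 2 - 2 * (u i * v i).
    by field; exact: lt0r_neq0.
  lra.
have := l2norm_ge0 u; rewrite le_eqVlt => /orP[/eqP u0|u_gt0]; last first.
  have := l2norm_ge0 v; rewrite le_eqVlt => /orP[/eqP v0|v_gt0]; last first.
    have := sum_le _ (divr_gt0 v_gt0 u_gt0).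
    have -> : l2norm v / l2norm u * l2norm u ^+ 2 +
      (l2norm v / l2norm u)^-1 * l2norm v ^+ 2 = 2 * (l2norm u * l2norm v).
      by field; rewrite !lt0r_neq0.
    lra.
  rewrite -v0 mulr0; apply/ler_addgt0Pr => eps eps_gt0; rewrite add0r.
  have := sum_le (2 * eps / l2norm u ^+ 2).
  rewrite divr_gt0 ?mulr_gt0 ?exprn_gt0// => /(_ isT).
  rewrite -v0 expr0n/= mulr0 addr0 divfK ?lt0r_neq0 ?exprn_gt0//; lra.
rewrite -u0 mul0r; apply/ler_addgt0Pr => eps eps_gt0; rewrite add0r.
have := sum_le ((l2norm v ^+ 2 + 1) / (2 * eps)).
have v1 : 0 < l2norm v ^+ 2 + 1 by rewrite ltr_wpDl ?sqr_ge0.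
rewrite divr_gt0 ?mulr_gt0// => /(_ isT).
rewrite -u0 expr0n/= mulr0 add0r invf_div => h.
have : 2 * eps / (l2norm v ^+ 2 + 1) * l2norm v ^+ 2 <= 2 * eps.
  rewrite -mulrA ler_piMr ?mulr_ge0 ?ltW// mulrC ltr_pdivrMr// mul1r; lra.
lra.
Qed.

(** The reverse triangle inequality, squared. *)
Lemma l2norm_dist u v :
  (l2norm u - l2norm v) ^+ 2 <= \sum_(i <- r) (u i - v i) ^+ 2.
Proof.
have -> : \sum_(i <- r) (u i - v i) ^+ 2 =
    l2norm u ^+ 2 + (- 2) * \sum_(i <- r) u i * v i + l2norm v ^+ 2.
  rewrite !sqr_l2norm mulr_sumr -!big_split/=; apply: eq_bigr => i _; ring.
have := l2norm_cauchy u v; rewrite sqrrB; lra.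
Qed.

End L2Norm.

(** * The norm of an almost harmonic Euclidean-valued map *)

Section ApproximateNorm.
Variables (R : realType) (V : choiceType) (e : rel V) (d : nat).
Variable nb : V -> {fset V}.
Hypothesis nbE : forall x y, (y \in nb x) = e x y.
Hypothesis nb_card : forall x, #|` nb x| = d.
Hypothesis e_sym : symmetric e.
Hypothesis d_gt0 : (0 < d)%N.

(* [m] imitates the norm of a harmonic map from the graph to a Hilbert space which
   vanishes at [o] and has mean squared edge length [1]. *)
Definition harmonic_norm (o : V) (n : nat) (delta : R) (m : V -> R) : Prop :=
  [/\ m o = 0, forall y, 0 <= m y,
      forall y, reach e n o y -> \sum_(z <- nb y) (m z - m y) ^+ 2 <= d%:R &
      forall y, reach e n o y ->
        `|\sum_(z <- nb y) (m z ^+ 2 - m y ^+ 2) - d%:R| <= delta].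

Lemma edge_lipschitz (m : V -> R) y z : e y z ->
  \sum_(z <- nb y) (m z - m y) ^+ 2 <= d%:R -> m z - m y <= Num.sqrt d%:R.
Proof.
move=> yz sum_le; have : (m z - m y) ^+ 2 <= d%:R.
  apply: le_trans sum_le; rewrite (big_fsetD1 z) ?nbE//= lerDl.
  by apply: sumr_ge0 => t _; exact: sqr_ge0.
rewrite -ler_sqrt ?ler0n// sqrtr_sqr; apply: le_trans; exact: ler_norm.
Qed.

(** The last edge of a walk of length [n.+1] starts within [n] steps of [o], where the edge bound is
    available. *)
Lemma reach_lipschitz (m : V -> R) o n k y : m o = 0 -> (k <= n.+1)%N ->
  (forall y, reach e n o y -> \sum_(z <- nb y) (m z - m y) ^+ 2 <= d%:R) ->
  reach e k o y -> m y <= k%:R * Num.sqrt d%:R.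
Proof.
move=> mo + mle; elim: k y => [|k IH] y kn.
  by move/reach0E => <-; rewrite mo mul0r.
move/reach_invr => [<-|[z oz zy]]; first by rewrite mo mulr_ge0 ?sqrtr_ge0.
have := IH _ (ltnW kn) oz.
have := edge_lipschitz zy (mle _ (reach_leq (kn : (k <= n)%N) oz)).
rewrite -natr1; lra.
Qed.

Hypothesis V_infinite : infinite_set [set: V].
Hypothesis e_conn : connected_graph e.
Hypothesis e_trans : transitive_graph e.
Hypothesis fol : folner R e.

Local Notation avg := (@averaging R V d nb).
Local Notation lap := (@laplacian R V d nb).
Local Notation energy := (@dirichlet_energy R V nb).

(** Almost harmonicity is homogeneous of degree two, so [f] can be rescaled to energy [E]; and
    [<f, Lf>] is at most the energy [2 * d * <f, Lf>]. *)
Lemma exists_near_harmonic_energy (E delta : R) : 0 < E -> 0 < delta ->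
  exists f, [/\ fin_supp f, energy f = E & dot (lap f) (lap f) <= delta * E].
Proof.
move=> E_gt0 delta_gt0.
have [f [ff flap fpos]] := exists_near_harmonic nbE nb_card e_sym d_gt0 V_infinite
  e_conn fol delta_gt0.
have fl := fin_supp_lap d nbE e_sym ff.
have dR : 0 < d%:R :> R by rewrite ltr0n.
have df_gt0 : 0 < d%:R * 2 * dot f (lap f) by rewrite !mulr_gt0.
pose s := Num.sqrt (E / (d%:R * 2 * dot f (lap f))).
have ss : s * s = E / (d%:R * 2 * dot f (lap f)).
  by rewrite -expr2 sqr_sqrtr// ltW// divr_gt0.
pose g x := s * f x + 0 * f x.
have gf : fin_supp g by exact: fin_supp_lin.
have lg : lap g = fun x => s * lap f x + 0 * lap f x by exact: lap_lin.
exists g; split => //.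
  rewrite (energyE nbE nb_card e_sym d_gt0)// lg.
  rewrite (dot_linl s 0 _ ff ff) (dot_linr s 0 _ fl fl) !mul0r !addr0.
  rewrite [s * (s * _)]mulrA ss.
  by field; rewrite !lt0r_neq0.
rewrite lg (dot_linl s 0 _ fl fl) (dot_linr s 0 _ fl fl) !mul0r !addr0.
rewrite [s * (s * _)]mulrA ss mulrAC ler_pdivrMr//.
rewrite (_ : _ * (_ * _ * _) = E * (delta * (d%:R * 2 * dot f (lap f)))); last ring.
rewrite ler_pM2l//.
apply: (le_trans flap).
rewrite ler_pM2l// ler_peMl ?(ltW fpos)//.
have : 1 <= d%:R :> R by rewrite ler1n.
lra.
Qed.

(** The vectors [u y], indexed by the finite set [T] of local automorphisms, form the almost
    harmonic map, and [m] is its norm. By mass transport, a function vanishing outside [W] sums over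
    [T] to [c * fsum] at each vertex of [B]; energy [d / c] for [f] thus makes the squared edge
    lengths at [y] add up to [d]. *)
Lemma exists_harmonic_norm o n (delta : R) : 0 < delta ->
  exists m, harmonic_norm o n delta m.
Proof.
move=> delta_gt0.
pose c : R := (multiplicity e nb o n.+1 o o)%:R.
have c_gt0 : 0 < c by rewrite ltr0n multiplicity_gt0.
have dR : 0 < d%:R :> R by rewrite ltr0n.
(* [s] is the weight in [2 |a b| <= s a^2 + s^-1 b^2], used in [bound]. As [m y ^ 2 <= n ^ 2 * d],
   this choice and that of [delta'] make each term at most [delta / (2 * d)]. *)
pose s : R := delta / (2 * d%:R ^+ 2 * (n%:R ^+ 2 + 1)).
have n1 : 0 < n%:R ^+ 2 + 1 :> R by rewrite ltr_wpDl ?sqr_ge0.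
have s_gt0 : 0 < s by rewrite divr_gt0 ?mulr_gt0 ?exprn_gt0.
pose delta' : R := delta * s / (2 * d%:R ^+ 2).
have delta'_gt0 : 0 < delta'.
  by apply: divr_gt0; [exact: mulr_gt0 | rewrite mulr_gt0// exprn_gt0].
have [f [[W0 W0f] fE flap]] :=
  exists_near_harmonic_energy (divr_gt0 dR c_gt0) delta'_gt0.
have ff : fin_supp f by exists W0.
(* Radius [n.+1] keeps in [B] the neighbours of the vertices within [n] steps. Not only [f] but also
   its Laplacian and its energy density vanish outside [W]. *)
pose B := gball nb n.+1 o; pose W := nbhd nb W0.
pose T := (\bigcup_(y <- B) fset_set (fiber e nb o n.+1 y W))%fset.
have oB : o \in B by apply/(gballP nbE); exact/(reach_leq (leq0n _))/reach0.
have sumT y (h : V -> R) : y \in B -> (forall x, x \notin W -> h x = 0) ->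
    \sum_(phi <- T) h (phi y) = c * fsum h.
  move=> yB Wh; rewrite (fsumE Wh) /c -(multiplicity_center nbE e_sym e_trans fol yB).
  apply: (sum_fiber nbE e_sym e_trans yB) => // phi.
    move=> /bigfcupP[z /andP[zB _]].
    by rewrite in_fset_set; [rewrite inE => -[]|exact: finite_fiber].
  move=> phiW; apply/bigfcupP; exists y; rewrite ?yB//.
  by rewrite in_fset_set ?inE//; exact: finite_fiber.
have TL phi : phi \in T -> local_aut e nb o n.+1 phi.
  move=> /bigfcupP[z /andP[zB _]].
  by rewrite in_fset_set; [rewrite inE => -[]|exact: finite_fiber].
pose u y (phi : V -> V) := f (phi y) - f (phi o).
pose m y := l2norm T (u y).
have inB y : reach e n o y -> y \in B.
  by move=> oy; apply/(gballP nbE); exact: reach_leq oy.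
have nbB y : reach e n o y -> forall z, e y z -> z \in B.
  by move=> oy z yz; apply/(gballP nbE); exact: reach_rcons oy yz.
have sum_edges y : reach e n o y ->
    \sum_(z <- nb y) \sum_(phi <- T) (u z phi - u y phi) ^+ 2 = d%:R.
  move=> oy; rewrite exchange_big /=.
  transitivity (\sum_(phi <- T) (fun x => \sum_(w <- nb x) (f w - f x) ^+ 2) (phi y)).
    rewrite [LHS]big_seq [RHS]big_seq; apply: eq_bigr => phi phiT /=.
    rewrite -(sum_nb_local_aut nbE (fun w => (f w - f (phi y)) ^+ 2) (TL _ phiT)
      (inB _ oy) (nbB _ oy)).
    by apply: eq_bigr => z _; rewrite /u; congr (_ ^+ 2); ring.
  rewrite (sumT _ (fun x => \sum_(w <- nb x) (f w - f x) ^+ 2))//; first last.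
  - exact: energy_supp.
  - exact: inB.
  by rewrite -/(energy f) fE mulrC divfK// lt0r_neq0.
have m_edges y : reach e n o y -> \sum_(z <- nb y) (m z - m y) ^+ 2 <= d%:R.
  by move=> oy; rewrite -(sum_edges _ oy); apply: ler_sum => z _; exact: l2norm_dist.
have mo : m o = 0.
  rewrite /m /l2norm big1 ?sqrtr0// => phi _.
  by rewrite /u subrr expr0n.
exists m; split => //; first by move=> y; exact: l2norm_ge0.
move=> y oy.
(* [|u z|^2 - |u y|^2] is [|u z - u y|^2] plus twice the inner product of [u y] and [u z - u y];
   summed over [z], these increments give [- d] times the Laplacian at [phi y]. *)
have -> : \sum_(z <- nb y) (m z ^+ 2 - m y ^+ 2) = d%:R +
    - 2 * d%:R * \sum_(phi <- T) u y phi * lap f (phi y).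
  rewrite -{1}(sum_edges _ oy) mulr_sumr.
  transitivity (\sum_(z <- nb y) (\sum_(phi <- T) (u z phi - u y phi) ^+ 2 +
     \sum_(phi <- T) 2 * (u y phi * (u z phi - u y phi)))).
    apply: eq_bigr => z _; rewrite /m !sqr_l2norm -big_split -sumrB/=.
    by apply: eq_bigr => phi _; ring.
  rewrite big_split/=; congr (_ + _); rewrite exchange_big/=.
  rewrite [LHS]big_seq [RHS]big_seq; apply: eq_bigr => phi phiT.
  rewrite -!mulr_sumr.
  have -> : \sum_(z <- nb y) (u z phi - u y phi) =
      \sum_(z <- nb y) (fun w => f w - f (phi y)) (phi z).
    by apply: eq_bigr => z _; rewrite /u; ring.
  rewrite (sum_nb_local_aut nbE (fun w => f w - f (phi y)) (TL _ phiT)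
    (inB _ oy) (nbB _ oy)).
  rewrite sumrB (sum_nb_const nb_card) (avgE nb d_gt0) /laplacian; ring.
rewrite addrC addKr.
have m_le : m y ^+ 2 <= n%:R ^+ 2 * d%:R.
  have my : m y <= n%:R * Num.sqrt d%:R by exact: (reach_lipschitz mo _ m_edges oy).
  have -> : n%:R ^+ 2 * d%:R = (n%:R * Num.sqrt d%:R) ^+ 2 :> R.
    by rewrite exprMn sqr_sqrtr.
  by apply: lerXn2r my; rewrite nnegrE ?mulr_ge0 ?sqrtr_ge0//; exact: l2norm_ge0.
have lap_le : \sum_(phi <- T) lap f (phi y) ^+ 2 <= delta' * d%:R.
  rewrite (sumT _ (fun x => lap f x ^+ 2)) ?inB//; last first.
    move=> x xW; rewrite /laplacian (avg_supp d nbE e_sym W0f xW) W0f.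
      by rewrite !mulr0 addr0 expr0n.
    by apply: contra xW; exact: sub_nbhd.
  have -> : fsum (fun x => lap f x ^+ 2) = dot (lap f) (lap f).
    by congr fsum; apply/funext => x; rewrite expr2.
  by move: flap; rewrite mulrA ler_pdivlMr// mulrC.
have bound : `|2 * \sum_(phi <- T) u y phi * lap f (phi y)| <=
    s * m y ^+ 2 + s^-1 * \sum_(phi <- T) lap f (phi y) ^+ 2.
  rewrite /m sqr_l2norm !mulr_sumr -big_split/=.
  apply: (le_trans (ler_norm_sum _ _ _)); apply: ler_sum => phi _.
  move: (u y phi) (lap f (phi y)) => a b.
  have p1 : 0 <= s * (a - s^-1 * b) ^+ 2 by rewrite mulr_ge0 ?sqr_ge0 ?ltW.
  have p2 : 0 <= s * (a + s^-1 * b) ^+ 2 by rewrite mulr_ge0 ?sqr_ge0 ?ltW.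
  have e1 : s * (a - s^-1 * b) ^+ 2 = s * a ^+ 2 + s^-1 * b ^+ 2 - 2 * (a * b).
    by field; exact: lt0r_neq0.
  have e2 : s * (a + s^-1 * b) ^+ 2 = s * a ^+ 2 + s^-1 * b ^+ 2 + 2 * (a * b).
    by field; exact: lt0r_neq0.
  by rewrite ler_norml; apply/andP; split; lra.
rewrite -mulrA mulNr normrN mulrCA normrM ger0_norm ?ler0n//.
apply: (le_trans (ler_wpM2l (ler0n R d) bound)).
have h1 : s * m y ^+ 2 <= delta / (2 * d%:R).
  apply: (@le_trans _ _ (s * (n%:R ^+ 2 * d%:R))).
    by rewrite ler_wpM2l// ltW.
  have -> : s * (n%:R ^+ 2 * d%:R) =
      delta / (2 * d%:R) * (n%:R ^+ 2 / (n%:R ^+ 2 + 1)).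
    by rewrite /s; field; rewrite !lt0r_neq0.
  rewrite ler_piMr ?divr_ge0 ?mulr_ge0 ?ltW// ltr_pdivrMr// mul1r; lra.
have h2 : s^-1 * \sum_(phi <- T) lap f (phi y) ^+ 2 <= delta / (2 * d%:R).
  apply: (@le_trans _ _ (s^-1 * (delta' * d%:R))).
    by rewrite ler_wpM2l// invr_ge0 ltW.
  rewrite /delta' le_eqVlt; apply/orP; left; apply/eqP.
  by field; rewrite !lt0r_neq0.
have -> : delta = d%:R * (delta / (2 * d%:R) + delta / (2 * d%:R)).
  by field; rewrite lt0r_neq0.
by rewrite ler_pM2l// lerD.
Qed.

End ApproximateNorm.

(** * The path metric through reachability *)

Section GraphDistance.
Variables (V : choiceType) (e : rel V).
Hypothesis e_conn : connected_graph e.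

Lemma graph_dist_walk x y : has_walk e x y (graph_dist e x y).
Proof.
rewrite /graph_dist; case: pselect => [xy|]; last first.
  by case; have [n w] := e_conn x y; exists n; apply/asboolP.
by case: ex_minnP => n /asboolP.
Qed.

Lemma graph_dist_le x y n : has_walk e x y n -> (graph_dist e x y <= n)%N.
Proof.
move=> w; rewrite /graph_dist; case: pselect => [xy|//].
by case: ex_minnP => k _; apply; apply/asboolP.
Qed.

Lemma graph_dist_reach x y n : reach e n x y -> (graph_dist e x y <= n)%N.
Proof. by move=> [k kn /graph_dist_le]; move/leq_trans; apply. Qed.

Lemma reach_graph_dist x y : reach e (graph_dist e x y) x y.
Proof. by exists (graph_dist e x y) => //; exact: graph_dist_walk. Qed.

Lemma graph_dist0 x y : graph_dist e x y = 0%N -> x = y.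
Proof. by move=> d0; apply: (@reach0E _ e); rewrite -d0; exact: reach_graph_dist. Qed.

Lemma graph_dist_edge x y : e x y -> (graph_dist e x y <= 1)%N.
Proof. by move=> xy; apply: graph_dist_le; exists [:: y]; rewrite /= xy. Qed.

End GraphDistance.

(** * Bounds on [iter t avg f o], the mean of [f] at time [t] from [o] *)

Section Diffusivity.
Variables (R : realType) (V : choiceType) (e : rel V) (d : nat).
Variable nb : V -> {fset V}.
Hypothesis nbE : forall x y, (y \in nb x) = e x y.
Hypothesis nb_card : forall x, #|` nb x| = d.
Hypothesis e_sym : symmetric e.
Hypothesis d_gt0 : (0 < d)%N.
Hypothesis V_infinite : infinite_set [set: V].
Hypothesis e_conn : connected_graph e.
Hypothesis e_trans : transitive_graph e.
Hypothesis fol : folner R e.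
Implicit Types (f g h m : V -> R) (o x y z : V).

Local Notation avg := (@averaging R V d nb).
Local Notation harmonic_norm := (@harmonic_norm R V e d nb).
Local Notation dist x y := ((graph_dist e x y)%:R : R).

Lemma ler_iter_avg t f g x : (forall y, reach e t x y -> f y <= g y) ->
  iter t avg f x <= iter t avg g x.
Proof.
elim: t x => [|t IH] x fg /=; first exact/fg/reach0.
apply: (ler_avg d nbE) => y xy; apply: IH => z yz; apply: fg.
exact: reach_step xy yz.
Qed.

Lemma iter_avg_lin t a b f g x :
  iter t avg (fun x => a * f x + b * g x) x =
  a * iter t avg f x + b * iter t avg g x.
Proof.
elim: t x => [//|t IH] x; rewrite !iterS -avg_lin.
by congr (averaging d nb _ x); apply/funext => y; exact: IH.
Qed.

Lemma iter_avg_cst t (a : R) x : iter t avg (fun=> a) x = a.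
Proof.
elim: t x => [//|t IH] x; rewrite iterS.
have -> : iter t avg (fun=> a) = fun=> a by apply/funext.
exact: avg_cst.
Qed.

Lemma iter_avg_affine t a b f x :
  iter t avg (fun x => a * f x + b) x = a * iter t avg f x + b.
Proof.
have := iter_avg_lin t a b f (fun=> 1) x.
by rewrite iter_avg_cst mulr1 => <-; congr (iter t avg _ x);
  apply/funext => y; rewrite mulr1.
Qed.

(** A discrete Dynkin inequality. The drift is used at times [s < t], when the walk is within [n]
    steps of [o], so [t = n.+1] is still allowed. *)
Lemma iter_avg_drift n t f h o : (t <= n.+1)%N ->
  (forall y, reach e n o y -> 1 * f y + 1 * h y <= avg f y) ->
  f o + \sum_(s < t) iter s avg h o <= iter t avg f o.
Proof.
move=> + fh; elim: t => [|t IH] tn; first by rewrite big_ord0 addr0.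
rewrite big_ord_recr/= addrA -/(iter t.+1 avg f o) iterSr.
have := IH (ltnW tn).
have : iter t avg (fun y => 1 * f y + 1 * h y) o <= iter t avg (avg f) o.
  by apply: ler_iter_avg => y oy; apply: fh; exact: reach_leq oy.
rewrite iter_avg_lin; lra.
Qed.

(** * Growth of the norm, the convex potential and the time spent near the start *)

Section Potential.
Variables (o : V) (n : nat) (delta : R) (m : V -> R).
Hypothesis delta_ge0 : 0 <= delta.
Hypothesis hm : harmonic_norm o n (d%:R * delta) m.

Let m0 : m o = 0. Proof. by case: hm. Qed.
Let m_ge0 y : 0 <= m y. Proof. by case: hm. Qed.
Let dR : 0 < d%:R :> R. Proof. by rewrite ltr0n. Qed.

Lemma avg_sqr_norm y : reach e n o y ->
  `|avg (fun z => m z ^+ 2) y - m y ^+ 2 - 1| <= delta.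
Proof.
case: hm => _ _ _ H /H.
rewrite sumrB (sum_nb_const nb_card) (avgE nb d_gt0).
rewrite -mulrBr -[X in _ - X]mulr1 -mulrBr normrM ger0_norm ?ler0n//.
by rewrite ler_pM2l.
Qed.

Lemma iter_avg_sqr_norm_ge t : (t <= n.+1)%N ->
  t%:R * (1 - delta) <= iter t avg (fun z => m z ^+ 2) o.
Proof.
move=> tn; have := @iter_avg_drift n t (fun z => m z ^+ 2) (fun=> 1 - delta) o tn.
rewrite m0 expr0n/= add0r (eq_bigr (fun=> 1 - delta)); last first.
  by move=> s _; rewrite iter_avg_cst.
rewrite sumr_const card_ord -[(1 - delta) *+ t]mulr_natl; apply => y /avg_sqr_norm.
rewrite ler_norml => /andP[]; lra.
Qed.

Lemma iter_avg_sqr_norm_le t : (t <= n.+1)%N ->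
  iter t avg (fun z => m z ^+ 2) o <= t%:R * (1 + delta).
Proof.
(* The upper bound is a lower bound on the drift of [- m ^ 2]. *)
move=> tn; have := @iter_avg_drift n t (fun z => (- 1) * m z ^+ 2 + 0)
  (fun=> - (1 + delta)) o tn.
rewrite m0 expr0n/= mulr0 add0r add0r (eq_bigr (fun=> - (1 + delta))); last first.
  by move=> s _; rewrite iter_avg_cst.
rewrite sumr_const card_ord -[(- (1 + delta)) *+ t]mulr_natl iter_avg_affine => H.
suff : t%:R * - (1 + delta) <= -1 * iter t avg (fun z => m z ^+ 2) o + 0 by lra.
apply: H => y oy; have /= := @iter_avg_affine 1 (- 1) 0 (fun z => m z ^+ 2) y.
move=> ->; have := avg_sqr_norm oy; rewrite ler_norml => /andP[]; lra.
Qed.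

Lemma norm_le_dist t y : (t <= n.+1)%N -> reach e t o y ->
  m y <= dist o y * Num.sqrt d%:R.
Proof.
move=> tn oy; case: hm => _ _ mle _.
have kn : (graph_dist e o y <= n.+1)%N by exact: leq_trans (graph_dist_reach oy) tn.
exact: (reach_lipschitz nbE m0 kn mle (reach_graph_dist e_conn o y)).
Qed.

(** Instead of Jensen: [m <= m ^ 2 / (2 * q) + q / 2] pointwise with [q = sqrt t], and the second
    moment is known. *)
Lemma iter_avg_norm_le t : (0 < t <= n.+1)%N ->
  iter t avg m o <= Num.sqrt t%:R * (1 + delta).
Proof.
move=> /andP[t_gt0 tn]; set q := Num.sqrt t%:R.
have q_gt0 : 0 < q by rewrite sqrtr_gt0 ltr0n.
have qq : t%:R = q * q :> R by rewrite -expr2 sqr_sqrtr.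
have : iter t avg m o <= iter t avg (fun z => (2 * q)^-1 * m z ^+ 2 + q / 2) o.
  apply: ler_iter_avg => y _.
  have -> : (2 * q)^-1 * m y ^+ 2 + q / 2 = m y + (m y - q) ^+ 2 / (2 * q).
    by field; rewrite lt0r_neq0.
  by rewrite lerDl divr_ge0 ?sqr_ge0// mulr_ge0// ltW.
rewrite iter_avg_affine => /le_trans; apply.
apply: (@le_trans _ _ ((2 * q)^-1 * (t%:R * (1 + delta)) + q / 2)).
  by rewrite lerD2r ler_wpM2l ?iter_avg_sqr_norm_le// invr_ge0 mulr_ge0// ltW.
have -> : (2 * q)^-1 * (t%:R * (1 + delta)) = q * (1 + delta) / 2.
  by rewrite qq; field; rewrite lt0r_neq0.
have : 0 <= q * delta by rewrite mulr_ge0// ltW.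
lra.
Qed.

Variable rho : R.
Hypothesis rho_ge : Num.sqrt d%:R <= rho.

Let rho_ge1 : 1 <= rho.
Proof.
by apply: le_trans rho_ge; rewrite -[leLHS]sqrtr1 ler_sqrt ?ler0n// ler1n.
Qed.

(* [sqrt (|x|^2 + 4 rho^2)] is convex, and uniformly so on the ball of radius
   [2 rho]; a jump from the ball of radius [rho] stays in that ball. *)
Definition potential y := Num.sqrt (m y ^+ 2 + 4 * rho ^+ 2).

Let under_ge0 y : 0 <= m y ^+ 2 + 4 * rho ^+ 2.
Proof. by have := sqr_ge0 (m y); have := sqr_ge0 rho; lra. Qed.

Lemma sqr_potential y : potential y ^+ 2 = m y ^+ 2 + 4 * rho ^+ 2.
Proof. by rewrite sqr_sqrtr. Qed.

Lemma potential_ge y : 2 * rho <= potential y.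
Proof.
have r1 := rho_ge1; have r0 : 0 <= 2 * rho by lra.
rewrite -[leLHS](ger0_norm r0) -sqrtr_sqr ler_sqrt//.
by rewrite exprMn -natrX lerDr sqr_ge0.
Qed.

Lemma potential_le y : potential y <= 1 * m y + 2 * rho.
Proof.
have r1 := rho_ge1; have my := m_ge0 y; have r0 : 0 <= 1 * m y + 2 * rho by lra.
rewrite -[leRHS](ger0_norm r0) -sqrtr_sqr ler_sqrt ?sqr_ge0//.
have : 0 <= m y * rho by rewrite mulr_ge0//; lra.
rewrite mul1r; nra.
Qed.

(** The potentials are the norms of the plane vectors [(m y, 2 rho)] and [(m z, 2 rho)]; the claim
    reduces to Cauchy-Schwarz for them. *)
Lemma potential_jump y z : (potential z - potential y) ^+ 2 <= (m z - m y) ^+ 2.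
Proof.
have r1 := rho_ge1; have uy := potential_ge y; have uz := potential_ge z.
have sy := sqr_potential y; have sz := sqr_potential z.
have my := m_ge0 y; have mz := m_ge0 z.
suff : m z * m y + 4 * rho ^+ 2 <= potential z * potential y by nra.
rewrite -(@ler_pXn2r _ 2)// ?nnegrE; first last.
- by rewrite mulr_ge0//; lra.
- by have := mulr_ge0 mz my; have := sqr_ge0 rho; lra.
rewrite exprMn sy sz.
have : 0 <= rho ^+ 2 * (m z - m y) ^+ 2 by rewrite mulr_ge0 ?sqr_ge0.
nra.
Qed.

(** The two differences have ratio [(m z + m y) / (potential z + potential y)], and [m <= 2 * rho]
    gives [2 * m ^ 2 <= potential ^ 2]. *)
Lemma potential_jump_half y z : m y <= 2 * rho -> m z <= 2 * rho ->
  2 * (potential z - potential y) ^+ 2 <= (m z - m y) ^+ 2.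
Proof.
move=> yr zr.
have r1 := rho_ge1; have uy := potential_ge y; have uz := potential_ge z.
have sy := sqr_potential y; have sz := sqr_potential z.
have my := m_ge0 y; have mz := m_ge0 z.
have p_gt0 : 0 < (potential z + potential y) ^+ 2 by rewrite exprn_gt0//; lra.
have diff : (potential z - potential y) * (potential z + potential y) =
    (m z - m y) * (m z + m y) by rewrite -!subr_sqr sy sz; ring.
rewrite -(ler_pM2r p_gt0) -mulrA -exprMn diff exprMn mulrCA ler_wpM2l ?sqr_ge0//.
have y2 : 2 * m y ^+ 2 <= potential y ^+ 2 by rewrite sy; nra.
have z2 : 2 * m z ^+ 2 <= potential z ^+ 2 by rewrite sz; nra.
suff : 2 * (m z * m y) <= potential z * potential y by nra.
rewrite -(@ler_pXn2r _ 2)// ?nnegrE; first last.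
- by rewrite mulr_ge0//; lra.
- by rewrite !mulr_ge0.
rewrite [leRHS]exprMn (_ : _ ^+ 2 = (2 * m z ^+ 2) * (2 * m y ^+ 2)); last ring.
by rewrite ler_pM ?mulr_ge0 ?sqr_ge0.
Qed.

(** As [potential ^ 2 - m ^ 2] is constant, [d * (1 - delta) <= 2 * u * S1 + S2], where [S1] is [d]
    times the drift and [S2 <= d]. If [m y <= rho], all neighbours have [m <= 2 * rho], so
    [S2 <= d / 2] and a positive drift remains, up to [delta]. *)
Lemma potential_drift y : reach e n o y ->
  1 * potential y + 1 * ((10 * rho)^-1 * (m y <= rho)%R%:R + - delta)
  <= avg potential y.
Proof.
move=> oy; have r1 := rho_ge1; have de0 := delta_ge0; set u := potential y.
have uy : 2 * rho <= u := potential_ge y.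
have u_gt0 : 0 < u by lra.
pose S1 := \sum_(z <- nb y) (potential z - u).
pose S2 := \sum_(z <- nb y) (potential z - u) ^+ 2.
have [_ _ /(_ _ oy) edges /(_ _ oy)] := hm.
rewrite ler_norml => /andP[growth _].
have S12 : \sum_(z <- nb y) (m z ^+ 2 - m y ^+ 2) = 2 * u * S1 + S2.
  rewrite mulr_sumr -big_split/=; apply: eq_bigr => z _.
  have := sqr_potential z; have := sqr_potential y; rewrite -/u => hy hz.
  have -> : m z ^+ 2 - m y ^+ 2 = potential z ^+ 2 - u ^+ 2 by rewrite hy hz; ring.
  ring.
have avgu : d%:R * (avg potential y - u) = S1.
  by rewrite /S1 sumrB (sum_nb_const nb_card) (avgE nb d_gt0) mulrBr.
set A := avg potential y in avgu *.
have S2le : S2 <= d%:R.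
  by apply: le_trans edges; apply: ler_sum => z _; exact: potential_jump.
rewrite S12 -avgu in growth.
have base : d%:R * (1 - delta) - S2 <= d%:R * (2 * u * (A - u)) by lra.
have du : delta <= delta * (2 * u).
  by rewrite ler_peMr//; lra.
have [myr|_] := boolP (m y <= rho); last first.
  have : d%:R * (- delta) <= d%:R * (2 * u * (A - u)) by lra.
  rewrite ler_pM2l// => h; rewrite mulr0 add0r.
  suff : - delta <= A - u by lra.
  by rewrite -(@ler_pM2l _ (2 * u)) ?mulr_gt0//; lra.
have S2half : 2 * S2 <= d%:R.
  apply: le_trans edges; rewrite mulr_sumr big_seq [leRHS]big_seq.
  apply: ler_sum => z; rewrite nbE => yz; apply: potential_jump_half; first lra.
  have [_ _ /(_ _ oy) edges' _] := hm.
  by have := edge_lipschitz nbE yz edges'; have := rho_ge; lra.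
have : d%:R * (2^-1 - delta) <= d%:R * (2 * u * (A - u)) by lra.
rewrite ler_pM2l// => h.
(* Here [u ^ 2 <= 5 * rho ^ 2] and [20 <= 25]; then [1 / 2] divided by [5 * rho] is
   [(10 * rho)^-1]. *)
have u_le : 2 * u <= 5 * rho.
  have r2 : 0 <= 5 * rho by lra.
  have u2 : 0 <= 2 * u by lra.
  rewrite -(@ler_pXn2r _ 2)// !exprMn (sqr_potential y : u ^+ 2 = _).
  have := m_ge0 y; nra.
have r_gt0 : 0 < 10 * rho by lra.
suff : (10 * rho)^-1 - delta <= A - u by rewrite /= mulr1 !mul1r; lra.
rewrite -(@ler_pM2l _ (2 * u)) ?mulr_gt0//; apply: le_trans h.
rewrite mulrBr lerB//; last by rewrite mulrC.
by rewrite ler_pdivrMr//; lra.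
Qed.

(** The potential starts at [2 * rho] and is at most [m + 2 * rho], so the accumulated drift is
    bounded by the mean of [m] alone. *)
Lemma visits_le_norm t : (t <= n.+1)%N ->
  \sum_(s < t) iter s avg (fun y => (m y <= rho)%R%:R) o <=
  10 * rho * (iter t avg m o + t%:R * delta).
Proof.
have r1 := rho_ge1; move=> tn; have := iter_avg_drift tn potential_drift.
have -> : potential o = 2 * rho.
  apply/eqP; rewrite eq_le potential_ge andbT; have := potential_le o.
  by rewrite m0 mulr0 add0r.
under eq_bigr do rewrite iter_avg_affine.
rewrite big_split/= -mulr_sumr sumr_const card_ord -[X in _ + (_ + X)]mulr_natl.
set S := \sum_(i < t) _ => h.
have : iter t avg potential o <= iter t avg m o + 2 * rho.
  rewrite -[X in X + _]mul1r -iter_avg_affine; apply: ler_iter_avg => y _.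
  exact: potential_le.
have r_gt0 : 0 < 10 * rho by lra.
move=> h'; rewrite -(@ler_pM2l _ (10 * rho)^-1) ?invr_gt0// mulKf ?lt0r_neq0//.
lra.
Qed.

End Potential.

(** * The three bounds, with the error [delta] made arbitrarily small *)

Let dR : 0 < d%:R :> R. Proof. by rewrite ltr0n. Qed.

Lemma exists_norm o n (delta : R) : 0 < delta ->
  exists m, harmonic_norm o n (d%:R * delta) m.
Proof.
by move=> d0; apply: (exists_harmonic_norm nbE nb_card) => //; exact: mulr_gt0.
Qed.

(** [m <= sqrt d * dist] passes the growth of [m ^ 2] to the distance. As [m] depends on [delta],
    the error [t * delta] is absorbed by an arbitrary [eps]. *)
Lemma dist_sqr_lower_bound o t :
  t%:R / d%:R <= iter t avg (fun y => dist o y ^+ 2) o.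
Proof.
rewrite ler_pdivrMr//; apply/ler_addgt0Pr => eps eps_gt0.
have t1 : 0 < t%:R + 1 :> R by rewrite ltr_wpDl.
pose delta := eps / (t%:R + 1); have d0 : 0 < delta by exact: divr_gt0.
have [m hm] := exists_norm o t d0.
have := iter_avg_sqr_norm_ge hm (leqnSn t).
have : iter t avg (fun z => m z ^+ 2) o <=
    iter t avg (fun z => d%:R * dist o z ^+ 2 + 0) o.
  apply: ler_iter_avg => y oy; have [_ m_ge0 _ _] := hm.
  have -> : d%:R * dist o y ^+ 2 + 0 = (dist o y * Num.sqrt d%:R) ^+ 2.
    by rewrite exprMn sqr_sqrtr ?ler0n// addr0 mulrC.
  apply: lerXn2r; rewrite ?nnegrE ?mulr_ge0 ?sqrtr_ge0//.
  exact: (norm_le_dist hm (leqnSn t)).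
rewrite iter_avg_affine.
have : t%:R * delta <= eps.
  by rewrite /delta mulrCA ler_piMr ?ltW// ltr_pdivrMr// mul1r ltrDl.
lra.
Qed.

(** The expected number of visits to [m <= 2 * q] is at least [t / 2], and at most [20 * q] times
    the mean of [m] up to the error; with [t = q * q] this yields [q / 40]. *)
Lemma dist_lower_bound o t : (d <= t)%N ->
  40^-1 * Num.sqrt (t%:R / d%:R) <= iter t avg (fun y => dist o y) o.
Proof.
move=> dt; have t_gt0 : 0 < t%:R :> R by rewrite ltr0n (leq_trans d_gt0).
have sd_gt0 : 0 < Num.sqrt d%:R :> R by rewrite sqrtr_gt0.
rewrite sqrtrM ?ler0n// sqrtrV ?ler0n// mulrA ler_pdivrMr//.
set q := Num.sqrt t%:R; have q_gt0 : 0 < q by rewrite sqrtr_gt0.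
have qq : t%:R = q * q :> R by rewrite -expr2 sqr_sqrtr// ltW.
apply/ler_addgt0Pr => eps eps_gt0.
have t1 : 0 < t%:R + eps by rewrite addr_gt0.
(* This gives both [delta <= 1] and [t * delta <= eps]. *)
pose delta := eps / (t%:R + eps); have d0 : 0 < delta by exact: divr_gt0.
have d1 : delta <= 1 by rewrite ler_pdivrMr// mul1r lerDr ltW.
have [m hm] := exists_norm o t d0.
have rho_ge : Num.sqrt d%:R <= 2 * q.
  have : Num.sqrt d%:R <= q by rewrite ler_sqrt ?ler0n// ler_nat.
  lra.
have := visits_le_norm (ltW d0) hm rho_ge (leqnSn t).
have : \sum_(s < t) 2^-1 <=
    \sum_(s < t) iter s avg (fun y => (m y <= 2 * q)%R%:R) o.
  apply: ler_sum => s _.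
  (* Chebyshev as a pointwise bound: the indicator is at least [1 - m ^ 2 / (4 * t)], whose mean is
     at least [1 / 2] because [1 + delta <= 2]. *)
  have : iter s avg (fun y => (- (4 * t%:R)^-1) * m y ^+ 2 + 1) o <=
      iter s avg (fun y => (m y <= 2 * q)%R%:R) o.
    apply: ler_iter_avg => y _; have [|] := leP (m y) (2 * q) => my /=.
      by rewrite mulNr gerDr oppr_le0 mulr_ge0 ?sqr_ge0// invr_ge0 mulr_ge0// ltW.
    rewrite mulNr addrC subr_le0 mulrC ler_pdivlMr ?mulr_gt0// qq; nra.
  rewrite iter_avg_affine; apply: le_trans.
  have sn : (s <= t.+1)%N by rewrite ltnW// ltnW// ltnS ltn_ord.
  have := iter_avg_sqr_norm_le hm sn.
  set M := iter s avg _ o => Mle.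
  have : (4 * t%:R)^-1 * M <= 2^-1.
    rewrite mulrC ler_pdivrMr ?mulr_gt0//; apply: (le_trans Mle).
    have : s%:R <= t%:R :> R by rewrite ler_nat ltnW.
    have : 0 <= s%:R :> R by [].
    nra.
  lra.
rewrite sumr_const card_ord -[2^-1 *+ t]mulr_natl => h1 h2.
have h3 := le_trans h1 h2.
have : iter t avg m o <= Num.sqrt d%:R * iter t avg (fun y => dist o y) o + 0.
  rewrite -iter_avg_affine; apply: ler_iter_avg => y oy.
  by rewrite addr0 mulrC; exact: (norm_le_dist hm (leqnSn t)).
have h4 : q * q * 2^-1 <= q * (20 * (iter t avg m o + t%:R * delta)).
  rewrite -qq; apply: (le_trans h3); lra.
have : q * 2^-1 <= 20 * (iter t avg m o + t%:R * delta).
  by rewrite -(ler_pM2l q_gt0) mulrA.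
have : t%:R * delta <= eps.
  by rewrite /delta mulrCA ler_piMr ?ltW// ltr_pdivrMr// mul1r ltrDl.
lra.
Qed.

(** [dist <= r] forces [m <= rho], and [1 <= r] supplies the bound [sqrt d <= rho] required by the
    potential; the mean of [m] is at most [sqrt t] up to the error. *)
Lemma visits_ball o t (r : R) : 1 <= r -> (0 < t)%N ->
  \sum_(s < t) iter s avg (fun y => (dist o y <= r)%R%:R) o <=
  10 * r * Num.sqrt d%:R * Num.sqrt t%:R.
Proof.
move=> r1 t_gt0; set q := Num.sqrt t%:R; set rho := r * Num.sqrt d%:R.
have q_ge0 : 0 <= q by exact: sqrtr_ge0.
have rho_ge : Num.sqrt d%:R <= rho by rewrite /rho ler_peMl// sqrtr_ge0.
have rho_ge0 : 0 <= rho by apply: le_trans rho_ge; exact: sqrtr_ge0.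
rewrite -[10 * r * _]mulrA -/rho; apply/ler_addgt0Pr => eps eps_gt0.
pose D := 10 * rho * (q + t%:R) + 1.
have D_gt0 : 0 < D by rewrite ltr_wpDl// mulr_ge0 ?addr_ge0// mulr_ge0.
pose delta := eps / D; have d0 : 0 < delta by exact: divr_gt0.
have [m hm] := exists_norm o t d0.
apply: (@le_trans _ _ (\sum_(s < t) iter s avg (fun y => (m y <= rho)%R%:R) o)).
  apply: ler_sum => s _; apply: ler_iter_avg => y oy.
  have st : (s <= t.+1)%N by rewrite ltnW// ltnW// ltnS ltn_ord.
  have [dr|_] := leP (dist o y) r; last exact: ler0n.
  have -> // : m y <= rho.
  by apply: (le_trans (norm_le_dist hm st oy)); rewrite ler_wpM2r// sqrtr_ge0.
apply: (le_trans (visits_le_norm (ltW d0) hm rho_ge (leqnSn t))).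
have := @iter_avg_norm_le o t delta m (ltW d0) hm t.
rewrite t_gt0 leqnSn => /(_ isT); rewrite -/q => mq.
apply: (@le_trans _ _ (10 * rho * (q * (1 + delta) + t%:R * delta))).
  by apply: ler_wpM2l; [exact: mulr_ge0 | rewrite lerD2r].
have : 10 * rho * (q + t%:R) * delta <= eps.
  by rewrite /delta mulrCA ler_piMr ?(ltW eps_gt0)// ler_pdivrMr// mul1r lerDl.
lra.
Qed.

(* The walk can only return to [o] from a neighbour of [o], and then with
   probability [1/d]. *)
Lemma visits_point o t : (0 < t)%N ->
  \sum_(s < t.+1) iter s avg (fun y => (y == o)%:R) o <=
  1 + 10 * Num.sqrt t%:R.
Proof.
move=> t_gt0; rewrite big_ord_recl /= eqxx lerD2l.
apply: (@le_trans _ _ (\sum_(s < t) (d%:R^-1 *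
    iter s avg (fun y => (dist o y <= 1)%R%:R) o + 0))).
  apply: ler_sum => s _; rewrite -iter_avg_affine -/(iter s.+1 avg _ o) iterSr.
  apply: ler_iter_avg => y _; rewrite addr0 /averaging ler_wpM2l ?invr_ge0//.
  have [yo|yo] := boolP (e y o).
    rewrite (big_fsetD1 o) ?nbE//= eqxx big_seq big1 ?addr0; last first.
      by move=> z; rewrite !inE => /andP[/negbTE ->].
    by rewrite lern1 graph_dist_edge// e_sym.
  rewrite big_seq big1// => z; rewrite nbE => yz; case: eqP => // zo.
  by move: yo; rewrite -zo yz.
rewrite big_split/= [X in _ + X]big1// addr0 -mulr_sumr.
have sd : d%:R = Num.sqrt d%:R * Num.sqrt d%:R :> R by rewrite -expr2 sqr_sqrtr.
have sd_ge1 : 1 <= Num.sqrt d%:R :> R.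
  by rewrite -[leLHS]sqrtr1 ler_sqrt ?ler0n// ler1n.
have := visits_ball o (lexx 1) t_gt0; rewrite mulr1.
set S := \sum_(_ < t) _ => Sle.
rewrite mulrC ler_pdivrMr//; apply: (le_trans Sle).
rewrite [X in _ <= _ * X]sd mulrAC ler_wpM2l// ?mulr_ge0 ?sqrtr_ge0//.
by rewrite ler_peMl// sqrtr_ge0.
Qed.

(** If [r >= 1], the ball bound at time [t.+1] applies, and [sqrt (t + 1) <= 3 / 2 * sqrt t] turns
    [10] into [15]. If [r < 1], the ball is the point [o], and [1 + 10 * q <= 15 * eps * t] since
    [1 <= eps * q]. *)
Lemma visits_upper_bound o t (eps : R) : (d <= t)%N ->
  (Num.sqrt t%:R)^-1 <= eps ->
  \sum_(s < t.+1) iter s avg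
    (fun y => (dist o y <= eps * Num.sqrt (t%:R / d%:R))%R%:R) o <=
  15 * eps * t%:R.
Proof.
move=> dt; have t_gt0 : (0 < t)%N by exact: leq_trans dt.
have tR : 1 <= t%:R :> R by rewrite ler1n.
set q := Num.sqrt t%:R.
have q_ge1 : 1 <= q by rewrite -[leLHS]sqrtr1 ler_sqrt.
have q_gt0 : 0 < q by lra.
have qq : t%:R = q * q :> R by rewrite -expr2 sqr_sqrtr.
rewrite -div1r ler_pdivrMr// => eq1.
have eps_ge0 : 0 <= eps by rewrite -(pmulr_lge0 _ q_gt0); lra.
have sd_gt0 : 0 < Num.sqrt d%:R :> R by rewrite sqrtr_gt0.
set r := eps * _.
have rE : r * Num.sqrt d%:R = eps * q.
  by rewrite /r sqrtrM ?ler0n// sqrtrV ?ler0n// -mulrA divfK// lt0r_neq0.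
have [r1|r1] := leP 1 r.
  apply: (le_trans (visits_ball o r1 (ltn0Sn t))).
  rewrite -[10 * r * _]mulrA rE.
  have : Num.sqrt t.+1%:R <= 3 / 2 * q.
    rewrite -(@ler_pXn2r _ 2)// ?nnegrE ?sqrtr_ge0 ?mulr_ge0 ?(ltW q_gt0)//.
    rewrite sqr_sqrtr// exprMn -natr1 [q ^+ 2]expr2 -qq; lra.
  have eq0 : 0 <= eps * q by rewrite mulr_ge0// ltW.
  move=> /(ler_wpM2l eq0); rewrite qq; lra.
apply: (@le_trans _ _ (\sum_(s < t.+1) iter s avg (fun y => (y == o)%:R) o)).
  apply: ler_sum => s _; apply: ler_iter_avg => y _.
  have [dr|_] := leP (dist o y) r; last exact: ler0n.
  have -> // : y == o.
  rewrite eq_sym; apply/eqP/(graph_dist0 e_conn).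
  have : dist o y < 1 by exact: le_lt_trans r1.
  by rewrite ltrn1 ltnS leqn0 => /eqP.
apply: (le_trans (visits_point o t_gt0)); rewrite -/q qq; nra.
Qed.

End Diffusivity.

(** * Integrals decomposed over the fibres of a discrete variable *)

Section DiscreteVariable.
Variables (disp : measure_display) (Omega : measurableType disp) (R : realType).
Variables (P : probability Omega R) (T : choiceType).
Hypothesis T_countable : countable [set: T].
Variable Y : Omega -> T.
Hypothesis mY : forall v, measurable (Y @^-1` [set v]).

Lemma measurable_preimage (A : set T) : measurable (Y @^-1` A).
Proof.
have -> : Y @^-1` A = \bigcup_v (if v \in A then Y @^-1` [set v] else set0).
  apply/seteqP; split => [w /= Aw|w [v _] /=].
    by exists (Y w) => //; rewrite mem_set.
  by case: ifPn => //; rewrite inE => Av ->.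
by apply: countable_bigcupT_measurable => // v; case: ifP.
Qed.

Lemma measurable_fun_discrete d' (U : measurableType d') (h : T -> U) (D : set Omega) :
  measurable_fun D (h \o Y).
Proof.
move=> mD B mB; apply: measurableI => //.
exact: (measurable_preimage (h @^-1` B)).
Qed.

(** Countable additivity over the fibres of [Y], enumerated through an injection [c] into [nat]. The
    two domains may differ, which allows the comparison of two events. *)
Lemma ge0_le_integral_fibers (D1 D2 : set Omega) (f g : Omega -> \bar R) :
  measurable D1 -> measurable D2 ->
  measurable_fun D1 f -> measurable_fun D2 g ->
  (forall w, 0 <= f w)%E -> (forall w, 0 <= g w)%E ->
  (forall v, \int[P]_(w in D1 `&` Y @^-1` [set v]) f w <=
             \int[P]_(w in D2 `&` Y @^-1` [set v]) g w)%E ->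
  (\int[P]_(w in D1) f w <= \int[P]_(w in D2) g w)%E.
Proof.
move=> mD1 mD2 mf mg f0 g0 fg.
have [c c_inj] := countable_injP _ T_countable.
pose F (D : set Omega) n := D `&` Y @^-1` [set v | c v = n].
have mF D n : measurable D -> measurable (F D n).
  by move=> mD; apply: measurableI => //; exact: measurable_preimage.
have UF D : \bigcup_n F D n = D.
  apply/seteqP; split => [w [n _ []//]|w Dw]; by exists (c (Y w)).
have tF D : trivIset [set: nat] (F D).
  by move=> i j _ _ [w [[_ /= <-] [_ /= <-]]].
have intF D h : measurable D -> measurable_fun D h -> (forall w, 0 <= h w)%E ->
    (\int[P]_(w in D) h w = \sum_(0 <= n <oo) \int[P]_(w in F D n) h w)%E.
  move=> mD mh h0; rewrite -[in LHS](UF D) ge0_integral_bigcup ?UF//.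
  by move=> n; exact: mF.
rewrite !intF//; apply: lee_nneseries => [n _ _|n _]; first exact: integral_ge0.
have [[v vn]|nv] := pselect (exists v, c v = n).
  have FvE D : F D n = D `&` Y @^-1` [set v].
    apply/seteqP; split => w [Dw /=].
      by rewrite -vn => /(c_inj _ _ (in_setT _) (in_setT _)).
    by move=> Yv; split => //=; rewrite Yv.
  by rewrite !FvE.
have F0 D : F D n = set0.
  by apply/seteqP; split => // w [_ /= wn]; apply: nv; exists (Y w).
by rewrite !F0 !integral_set0.
Qed.

Lemma integral_eq_fibers (D : set Omega) (f g : Omega -> \bar R) :
  measurable D -> measurable_fun D f -> measurable_fun D g ->
  (forall w, 0 <= f w)%E -> (forall w, 0 <= g w)%E ->
  (forall v, \int[P]_(w in D `&` Y @^-1` [set v]) f w =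
             \int[P]_(w in D `&` Y @^-1` [set v]) g w)%E ->
  (\int[P]_(w in D) f w = \int[P]_(w in D) g w)%E.
Proof.
move=> mD mf mg f0 g0 fg; apply/eqP; rewrite eq_le.
by apply/andP; split; apply: ge0_le_integral_fibers => // v; rewrite fg.
Qed.

Lemma probability_eq_fibers (D1 D2 : set Omega) (q : R) :
  measurable D1 -> measurable D2 -> 0 <= q ->
  (forall v, P (D1 `&` Y @^-1` [set v]) = P (D2 `&` Y @^-1` [set v]) * q%:E)%E ->
  (P D1 = P D2 * q%:E)%E.
Proof.
move=> mD1 mD2 q0 H.
have -> : P D1 = (\int[P]_(w in D1) cst 1%:E w)%E by rewrite integral_cst// mul1e.
have -> : (P D2 * q%:E = \int[P]_(w in D2) cst q%:E w)%E.
  by rewrite integral_cst// muleC.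
have E v : (\int[P]_(w in D1 `&` Y @^-1` [set v]) cst 1%:E w =
            \int[P]_(w in D2 `&` Y @^-1` [set v]) cst q%:E w)%E.
  rewrite !integral_cst; [|exact: measurableI..].
  by rewrite mul1e muleC; exact: H.
apply/eqP; rewrite eq_le; apply/andP.
by split; apply: ge0_le_integral_fibers => // v; rewrite E.
Qed.

End DiscreteVariable.

(** * From the random walk to iterated averages *)

Section Transfer.
Variables (R : realType) (V : choiceType) (e : rel V) (d : nat).
Variable nb : V -> {fset V}.
Hypothesis nbE : forall x y, (y \in nb x) = e x y.
Hypothesis V_countable : countable [set: V].
Variables (disp : measure_display) (Omega : measurableType disp).
Variables (P : probability Omega R) (X : nat -> Omega -> V).
Hypothesis srw : simple_random_walk e d P X.

Local Notation avg := (@averaging R V d nb).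

Let mX t v : measurable (X t @^-1` [set v]). Proof. by case: srw. Qed.

(** [D] marks the times at which the position remains prescribed. *)
Let path_event (D : pred nat) t (x : nat -> V) : set Omega :=
  [set w | forall s, (s <= t)%N -> D s -> X s w = x s].

Let measurable_path_event D t x : measurable (path_event D t x).
Proof.
have -> : path_event D t x =
    \bigcap_s (if (s <= t)%N && D s then X s @^-1` [set x s] else setT).
  apply/seteqP; split => [w H s _|w H s st Ds].
    by case: ifP => // /andP[st Ds]; exact: H.
  by have := H s I; rewrite st Ds.
by apply: bigcapT_measurable => s; case: ifP.
Qed.

(* The coordinates [1 .. k] other than [t] are summed out one at a time. *)
Lemma markov_forget k t (x : nat -> V) y : (k <= t)%N ->
  (P (path_event [pred s | [|| s == 0, k < s | s == t]]%N t x `&` X t.+1 @^-1` [set y]) =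
   P (path_event [pred s | [|| s == 0, k < s | s == t]]%N t x)
     * (srw_step R e d (x t) y)%:E)%E.
Proof.
elim: k x => [|k IH] x kt.
  case: srw => _ /(_ t x y) H.
  have E : path_event [pred s | [|| s == 0, 0 < s | s == t]]%N t x =
      [set w | forall s, (s <= t)%N -> X s w = x s].
    apply/seteqP; split => w Hw s st; last by move=> _; exact: Hw.
    by apply: Hw => //=; case: s st.
  by rewrite E; exact: H.
(* Time [t] stays prescribed by the clause [s == t], so in the first case nothing is summed out. *)
have [kt'|kt'] := eqVneq k.+1 t.
  have E z : path_event [pred s | [|| s == 0, k.+1 < s | s == t]]%N t z =
      path_event [pred s | [|| s == 0, k < s | s == t]]%N t z.
    have DE s : [|| s == 0, k.+1 < s | s == t]%N = [|| s == 0, k < s | s == t]%N.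
      rewrite [(k < s)%N]leq_eqVlt -kt' [s == k.+1]eq_sym.
      by case: (_ == s); rewrite ?orbT ?orbF.
    by apply/seteqP; split => w Hw s st Ds; apply: Hw => //=; move: Ds; rewrite /= DE.
  by rewrite E IH// ltnW.
have q0 : 0 <= srw_step R e d (x t) y.
  by rewrite /srw_step; case: ifP => // _; rewrite invr_ge0.
apply: (probability_eq_fibers V_countable (Y := X k.+1)) => // [|v].
  by apply: measurableI.
pose x' s := if s == k.+1 then v else x s.
have E : path_event [pred s | [|| s == 0, k.+1 < s | s == t]]%N t x `&`
      X k.+1 @^-1` [set v] =
    path_event [pred s | [|| s == 0, k < s | s == t]]%N t x'.
  apply/seteqP; split => w /=.
    move=> [Hw Hv] s st /= Ds; rewrite /x'; case: eqP => [->//|/eqP sk].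
    by apply: Hw => //=; move: Ds; rewrite [(k.+1 < s)%N]ltn_neqAle [k.+1 == s]eq_sym sk.
  move=> Hw; split => [s st /= Ds|].
    have [sk|sk] := eqVneq s k.+1; first by move: Ds; rewrite sk (negbTE kt') ltnn.
    have := Hw s st; rewrite /x' /= (negbTE sk); apply; move: Ds.
    by rewrite [(k.+1 < s)%N]ltn_neqAle [k.+1 == s]eq_sym sk.
  by have := Hw k.+1 kt; rewrite /x' /= eqxx; apply; rewrite ltnSn.
have := IH x' (ltnW kt); rewrite (_ : x' t = x t) -?E; last first.
  by rewrite /x' eq_sym (negbTE kt').
by rewrite setIAC.
Qed.

(** [markov_forget] with [k = t] leaves only the times [0] and [t]; these coincide when [t = 0]. *)
Lemma markov_step t x z y :
  (P (X 0%N @^-1` [set x] `&` X t @^-1` [set z] `&` X t.+1 @^-1` [set y]) =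
   P (X 0%N @^-1` [set x] `&` X t @^-1` [set z]) * (srw_step R e d z y)%:E)%E.
Proof.
have q0 : 0 <= srw_step R e d z y.
  by rewrite /srw_step; case: ifP => // _; rewrite invr_ge0.
case: t => [|t].
  have [->|xz] := eqVneq x z; last first.
    have -> : X 0%N @^-1` [set x] `&` X 0%N @^-1` [set z] = set0.
      apply/seteqP; split => // w [/= -> /eqP]; by rewrite (negbTE xz).
    by rewrite set0I measure0 mul0e.
  have := @markov_forget 0 0 (fun=> z) y (leqnn _).
  have -> : path_event [pred s | [|| s == 0, 0 < s | s == 0]]%N 0 (fun=> z) =
      X 0%N @^-1` [set z] `&` X 0%N @^-1` [set z].
    rewrite setIid; apply/seteqP; split => w /=; first by apply.
    by move=> Hw s; rewrite leqn0 => /eqP ->.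
  by [].
have := @markov_forget t.+1 t.+1 (fun s => if s == 0%N then x else z) y (leqnn _).
have -> : path_event [pred s | [|| s == 0, t.+1 < s | s == t.+1]]%N t.+1
    (fun s => if s == 0%N then x else z) =
    X 0%N @^-1` [set x] `&` X t.+1 @^-1` [set z].
  apply/seteqP; split => w /=.
    by move=> Hw; split; [exact: (Hw 0%N) | apply: (Hw t.+1); rewrite //= eqxx orbT].
  move=> [H0 Ht] s st; case: s st => [_ _|s st] /=; first by rewrite H0.
  rewrite ltnNge (leq_trans st)//= => /eqP [->] //.
by [].
Qed.

(** Induction on [t] by averaging the last step: on [X t = z], the integral of [G (X t.+1)] is that
    of [avg G z]. The product with the probability of the start avoids conditioning on null
    events. *)
Lemma integral_from x t (G : V -> R) : (forall y, 0 <= G y) ->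
  (\int[P]_(w in X 0%N @^-1` [set x]) (G (X t w))%:E =
   (iter t avg G x)%:E * P (X 0%N @^-1` [set x]))%E.
Proof.
elim: t G => [|t IH] G G0.
  rewrite -integral_cst//; apply: eq_integral => w.
  by rewrite inE /= => ->.
have avg0 y : 0 <= avg G y.
  by rewrite mulr_ge0 ?invr_ge0 ?sumr_ge0.
rewrite iterSr -IH//; set D := X 0%N @^-1` [set x].
have mD : measurable D by exact: mX.
have mG s (H : V -> R) A : measurable_fun A (fun w => (H (X s w))%:E).
  exact: (@measurable_fun_discrete _ _ _ V_countable (X s) (mX s) _ _
    (fun v => (H v)%:E)).
apply: (integral_eq_fibers V_countable (mX t)) => // [w|w|z]; rewrite ?lee_fin//.
set D' := D `&` _; have mD' : measurable D' by exact: measurableI.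
(* [S] agrees with [G] on the neighbours of [z], which carry all the mass of [X t.+1] on [D'], and
   as a finite sum it commutes with the integral. *)
pose S v := \sum_(y <- nb z) G y * (v == y)%:R.
have S0 v : 0 <= S v by apply: sumr_ge0 => y _; rewrite mulr_ge0.
transitivity (\int[P]_(w in D') (S (X t.+1 w))%:E)%E.
  apply: (integral_eq_fibers V_countable (mX t.+1)) => // [w|w|y]; rewrite ?lee_fin//.
  have mDy : measurable (D' `&` X t.+1 @^-1` [set y]) by exact: measurableI.
  have cst_on (H : V -> R) :
    (\int[P]_(w in D' `&` X t.+1 @^-1` [set y]) (H (X t.+1 w))%:E =
     (H y)%:E * P (D' `&` X t.+1 @^-1` [set y]))%E.
    rewrite -integral_cst//; apply: eq_integral => w.
    by rewrite inE => -[_ /= ->].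
  rewrite !cst_on /D' markov_step /srw_step.
  case: ifPn => [zy|_]; last by rewrite !mule0.
  congr (_%:E * _)%E; rewrite /S (big_fsetD1 y) ?nbE//= eqxx mulr1.
  rewrite big_seq big1 ?addr0// => v; rewrite !inE => /andP[/negbTE vy _].
  by rewrite eq_sym vy mulr0.
transitivity ((avg G z)%:E * P D')%E; last first.
  rewrite -integral_cst//; apply: eq_integral => w.
  by rewrite inE => -[_ /= ->].
under eq_integral do rewrite /S -sumEFin.
rewrite ge0_integral_sum//; last first.
- by move=> y w _; rewrite lee_fin mulr_ge0.
- by move=> y; exact: (mG t.+1 (fun v => G y * (v == y)%:R)).
have int1 y : (\int[P]_(w in D') (G y * (X t.+1 w == y)%:R)%:E =
    (G y)%:E * (P D' * (srw_step R e d z y)%:E))%E.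
  under eq_integral do rewrite EFinM.
  rewrite ge0_integralZl_EFin//; last exact: (mG t.+1 (fun v => (v == y)%:R)).
  congr (_ * _)%E; rewrite -markov_step -/D -/D' setIC -integral_indic//.
  apply: eq_integral => w _; rewrite indicE.
  by case: eqP => yw; [rewrite mem_set | rewrite memNset].
under eq_bigr do rewrite int1.
have PD : P D' \is a fin_num by rewrite fin_num_measure.
rewrite -(fineK PD).
under eq_bigr do rewrite -!EFinM.
rewrite sumEFin -EFinM; congr (_%:E).
rewrite /averaging -mulrA mulr_suml mulr_sumr big_seq [RHS]big_seq.
by apply: eq_bigr => y; rewrite nbE /srw_step => ->; ring.
Qed.

Let mXX t (H : V -> V -> R) A : measurable_fun A (fun w => (H (X 0%N w) (X t w))%:E).
Proof.
have VV : countable [set: V * V].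
  by rewrite -setXTT; exact: countableX.
have mZ (v : V * V) : measurable ((fun w => (X 0%N w, X t w)) @^-1` [set v]).
  have -> : (fun w => (X 0%N w, X t w)) @^-1` [set v] =
      X 0%N @^-1` [set v.1] `&` X t @^-1` [set v.2].
    by case: v => a b; apply/seteqP; split => w /=; [case=> -> -> | case=> -> ->].
  exact: measurableI.
exact: (@measurable_fun_discrete _ _ _ VV _ mZ _ _ (fun v => (H v.1 v.2)%:E)).
Qed.

(** The bound holds from every vertex, so it can be integrated over the fibres of [X 0], whatever
    its law. *)
Lemma integral_walk_ge t (F : V -> V -> R) (c : R) : 0 <= c ->
  (forall x y, 0 <= F x y) -> (forall x, c <= iter t avg (F x) x) ->
  (c%:E <= \int[P]_w (F (X 0%N w) (X t w))%:E)%E.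
Proof.
move=> c0 F0 Fc.
have -> : c%:E = (\int[P]_(w in setT) cst c%:E w)%E.
  rewrite integral_cst// -[LHS]mule1; congr (_ * _)%E.
  exact/esym/probability_setT.
apply: (ge0_le_integral_fibers V_countable (mX 0%N)) => // [w|x]; rewrite ?lee_fin//.
rewrite setTI integral_cst//.
have -> : (\int[P]_(w in X 0%N @^-1` [set x]) (F (X 0%N w) (X t w))%:E =
    \int[P]_(w in X 0%N @^-1` [set x]) (F x (X t w))%:E)%E.
  by apply: eq_integral => w; rewrite inE /= => ->.
by rewrite integral_from// lee_wpmul2r// lee_fin.
Qed.

(** Only the sum over times is bounded uniformly in the start, so the indicators are summed under
    one integral before splitting over the fibres of [X 0]. *)
Lemma sum_probability_walk_le n (A : V -> V -> bool) (c : R) : 0 <= c ->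
  (forall x, \sum_(s < n) iter s avg (fun y => (A x y)%:R) x <= c) ->
  (\sum_(0 <= s < n) P [set w | A (X 0%N w) (X s w)] <= c%:E)%E.
Proof.
move=> c0 Ac; pose F x y : R := (A x y)%:R.
have -> : c%:E = (\int[P]_(w in setT) cst c%:E w)%E.
  rewrite integral_cst// -[LHS]mule1; congr (_ * _)%E.
  exact/esym/probability_setT.
have -> : (\sum_(0 <= s < n) P [set w | A (X 0%N w) (X s w)] =
    \int[P]_w \sum_(0 <= s < n) (F (X 0%N w) (X s w))%:E)%E.
  rewrite ge0_integral_sum//=; last by move=> s w _; rewrite lee_fin.
  apply: eq_bigr => s _.
  have mA : measurable [set w | A (X 0%N w) (X s w)].
    have := @mXX s F setT measurableT [set 1%:E]; rewrite setTI.
    have -> : (fun w => (F (X 0%N w) (X s w))%:E) @^-1` [set 1%:E] =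
        [set w | A (X 0%N w) (X s w)].
      apply/seteqP; split => w /=; rewrite /F; last by move=> ->.
      by case: (A _ _) => //= -[] /eqP; rewrite eq_sym oner_eq0.
    by apply; exact: emeasurable_set1.
  rewrite -[in LHS](setIT [set w | _]) -integral_indic//.
  apply: eq_integral => w _; rewrite indicE /F.
  by case: (boolP (A _ _)) => Aw; [rewrite mem_set | rewrite memNset//; apply/negP].
apply: (ge0_le_integral_fibers V_countable (mX 0%N)) => //.
- by apply: emeasurable_sum => s; exact: mXX.
- by move=> w; apply: sume_ge0 => s _; rewrite lee_fin.
move=> x; rewrite setTI integral_cst// ge0_integral_sum//; last first.
  by move=> s w _; rewrite lee_fin.
have E s : (\int[P]_(w in X 0%N @^-1` [set x]) (F (X 0%N w) (X s w))%:E =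
    (iter s avg (F x) x)%:E * P (X 0%N @^-1` [set x]))%E.
  rewrite -integral_from//.
  by apply: eq_integral => w; rewrite inE /= => ->.
under eq_bigr do rewrite E.
have PD : P (X 0%N @^-1` [set x]) \is a fin_num by rewrite fin_num_measure.
pose p := fine (P (X 0%N @^-1` [set x])).
have Pp : P (X 0%N @^-1` [set x]) = p%:E by rewrite fineK.
rewrite [Z in (_ <= _ * Z)%E](Pp : _ = _) Pp.
under eq_bigr do rewrite -EFinM.
rewrite sumEFin -EFinM lee_fin -mulr_suml big_mkord ler_wpM2r//.
  by rewrite /p fine_ge0.
exact: Ac.
Qed.

End Transfer.

(** * Neighbour sets, countability and the Folner condition from the hypotheses on the graph *)

Section GraphFacts.
Variables (R : realType) (V : choiceType) (e : rel V) (d : nat).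
Hypothesis e_sym : symmetric e.
Hypothesis V_infinite : infinite_set [set: V].
Hypothesis e_conn : connected_graph e.
Hypothesis e_reg : regular_graph e d.

Definition neighbors x : {fset V} := fset_set [set y | e x y].

Lemma neighborsE x y : (y \in neighbors x) = e x y.
Proof.
rewrite in_fset_set; last by apply/finite_setP; exists d; exact: e_reg.
by apply/idP/idP; rewrite inE.
Qed.

Lemma card_neighbors x : #|` neighbors x| = d.
Proof. exact: card_fset_set. Qed.

Lemma degree_gt0 : (0 < d)%N.
Proof.
have [x _] := infinite_setN0 V_infinite.
have [y xy] : exists y, y != x.
  apply: contrapT => nxy; apply: V_infinite.
  apply: (@sub_finite_set _ _ [set x]) => // y _ /=.
  by apply/eqP; apply: contrapT => /negP yx; apply: nxy; exists y.
have := reach_graph_dist e_conn x y.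
case: (graph_dist e x y) => [/reach0E xy'|n /reach_inv [xy'|[z xz _]]].
- by move: xy; rewrite xy' eqxx.
- by move: xy; rewrite xy' eqxx.
rewrite -(card_neighbors x) cardfs_gt0; apply/fset0Pn; exists z.
by rewrite neighborsE.
Qed.

Lemma vertices_countable : countable [set: V].
Proof.
have [x _] := infinite_setN0 V_infinite.
have -> : [set: V] = \bigcup_n [set` gball neighbors n x].
  apply/seteqP; split => // y _; exists (graph_dist e x y) => //=.
  by apply/(gballP neighborsE); exact: reach_graph_dist.
by apply: bigcup_countable.
Qed.

(** The symmetric difference itself serves as [B], since it contains every neighbour of [S] outside
    [S]. *)
Lemma amenable_folner : amenable_graph R e -> folner R e.
Proof.
move=> [S [Sfin S_neq0 S_lim]] eta eta_gt0.
move/cvgrPdist_lt : S_lim => /(_ _ eta_gt0) [n _ /(_ n (leqnn n))] /=.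
pose N := (\bigcup_(x <- fset_set (S n)) neighbors x)%fset.
have NS : neighborhood e (S n) `<=` [set` N].
  move=> y [x Sx xy] /=; apply/bigfcupP; exists x; rewrite ?neighborsE//.
  by rewrite andbT in_fset_set// mem_set.
have DSfin : finite_set (S n `+` neighborhood e (S n)).
  apply: (@sub_finite_set _ _ (S n `|` [set` N])).
    by move=> y [[Sy _]|[/NS Ny _]]; [left|right].
  by rewrite finite_setU; split => //; exact: finite_fset.
set B := fset_set _; set A := fset_set (S n) => small.
have A_neq0 : A != fset0.
  have [x Sx] := S_neq0 n; apply/fset0Pn; exists x.
  by rewrite in_fset_set// mem_set.
exists A, B; split => // [x y|].
  rewrite !in_fset_set// !inE => Sx xy Sy; right; split; first by exists x.
  by move=> Sny; move: Sy; rewrite mem_set.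
have A_gt0 : 0 < #|` A|%:R :> R by rewrite ltr0n cardfs_gt0.
rewrite -ler_pdivrMr//; apply/ltW; move: small.
by rewrite sub0r normrN ger0_norm// divr_ge0.
Qed.

End GraphFacts.

Theorem theorem1p1 (R : realType) :
  exists C C' : R, [/\ 0 < C, 1 <= C' &
    forall (V : choiceType) (e : rel V) (d : nat),
      symmetric e ->
      infinite_set [set: V] ->
      connected_graph e ->
      amenable_graph R e ->
      transitive_graph e ->
      regular_graph e d ->
    forall (disp : measure_display) (Omega : measurableType disp)
      (P : probability Omega R) (X : nat -> Omega -> V),
      simple_random_walk e d P X ->
    [/\ forall t : nat,
          ((t%:R / d%:R)%:E
           <= 'E_P[(fun w => (graph_dist e (X 0%N w) (X t w))%:R ^+ 2 : R)%R])%E,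
        forall t : nat, (d <= t)%N ->
          ((C * Num.sqrt (t%:R / d%:R))%:E
           <= 'E_P[(fun w => (graph_dist e (X 0%N w) (X t w))%:R : R)%R])%E &
        forall t : nat, (d <= t)%N ->
        forall eps : R, (Num.sqrt t%:R)^-1 <= eps ->
          ((t%:R^-1)%:E *
             \sum_(0 <= s < t.+1)
               P [set w | ((graph_dist e (X 0%N w) (X s w))%:R
                           <= eps * Num.sqrt (t%:R / d%:R))%R]
           <= (C' * eps)%:E)%E]].
Proof.
(* The constants of [dist_lower_bound] and [visits_upper_bound]. *)
exists 40^-1, 15; split; [by rewrite invr_gt0 | by rewrite ler1n |].
move=> V e d e_sym V_inf e_conn e_amen e_trans e_reg disp Omega P X srw.
have nbE := neighborsE e_reg; have nb_card := card_neighbors e_reg.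
have d_gt0 := degree_gt0 V_inf e_conn e_reg.
have V_count := vertices_countable V_inf e_conn e_reg.
have fol := amenable_folner e_reg e_amen.
split => [t|t dt|t dt eps eps_ge].
- rewrite unlock; apply: (integral_walk_ge nbE V_count srw
    (F := fun x y => (graph_dist e x y)%:R ^+ 2)) => // x.
  exact: (dist_sqr_lower_bound nbE nb_card).
- rewrite unlock; apply: (integral_walk_ge nbE V_count srw
    (F := fun x y => (graph_dist e x y)%:R)) => // x.
  exact: (dist_lower_bound nbE nb_card).
have t_gt0 : 0 < t%:R :> R by rewrite ltr0n (leq_trans d_gt0).
have eps_ge0 : 0 <= eps by apply: le_trans eps_ge; rewrite invr_ge0 sqrtr_ge0.
have -> : (15 * eps)%:E = ((t%:R^-1)%:E * (15 * eps * t%:R)%:E)%E.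
  by rewrite -EFinM [in RHS]mulrC mulfK// lt0r_neq0.
rewrite lee_wpmul2l ?lee_fin ?invr_ge0 ?ler0n//.
apply: (sum_probability_walk_le nbE V_count srw
  (A := fun x y => (graph_dist e x y)%:R <= eps * Num.sqrt (t%:R / d%:R))) => [|x].
  by rewrite !mulr_ge0.
exact: (visits_upper_bound nbE nb_card).
Qed.
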